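(* Let $1\le\nu<\infty$, let $\phi(z)=az+b$ with $|a|=1$, $b\in\mathbb{C}$, and let $w$ be an entire function such that $W_{w,\phi}$ is bounded on $\mathcal{F}^\nu$. Then $W_{w,\phi}$ is power-bounded on $\mathcal{F}^\nu$ if and only if $|w(0)|\le e^{-|b|^2/2}$.
   Context: For $1\le\nu<\infty$, $\mathcal{F}^\nu$ is the space of entire functions $f$ with $\|f\|_\nu:=\left(\frac{\nu}{2\pi}\int_{\mathbb{C}}|f(z)|^\nu e^{-\nu|z|^2/2}\,dm(z)\right)^{1/\nu}<\infty$. $W_{w,\phi}f=w\,(f\circ\phi)$. An operator $T$ is power-bounded if $\sup_{n\ge1}\|T^n\|<\infty$. (For $|a|=1$ and $w\not\equiv0$, boundedness of $W_{w,\phi}$ on $\mathcal{F}^\nu$ forces $w(z)=w(0)e^{-\overline{b}az}$.) *)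

(* Defs.v *)
From HB Require Import structures.
From mathcomp Require Import all_boot all_order all_algebra.
From mathcomp Require Import all_classical all_reals all_analysis.
From mathcomp Require Import complex.
Set Implicit Arguments. Unset Strict Implicit. Unset Printing Implicit Defensive.
Import Order.TTheory GRing.Theory Num.Theory.
Import numFieldNormedType.Exports.
Local Open Scope ring_scope.
Local Open Scope complex_scope.

Definition cabs (R : realType) (z : R[i]) : R := Normc.normc z.

Definition entire (R : realType) (f : R[i] -> R[i]) : Prop :=
  forall z : R[i], derivable (f : R[i]^o -> R[i]^o) z 1.

Definition fock_integral (R : realType) (nu : R) (f : R[i] -> R[i]) : \bar R :=
  (\int[(@lebesgue_measure R \x @lebesgue_measure R)%E]_(p in [set: R * R])
     ((cabs (f (p.1 +i* p.2)) `^ nu) * expR (- nu * (p.1 ^+ 2 + p.2 ^+ 2) / 2))%:E)%E.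

Definition in_fock (R : realType) (nu : R) (f : R[i] -> R[i]) : Prop :=
  entire f /\ (fock_integral nu f < +oo)%E.

Definition fock_norm (R : realType) (nu : R) (f : R[i] -> R[i]) : R :=
  (nu / (2 * pi) * fine (fock_integral nu f)) `^ (1 / nu).

Definition Wop (R : realType) (w : R[i] -> R[i]) (a b : R[i])
  (f : R[i] -> R[i]) : R[i] -> R[i] := fun z => w z * f (a * z + b).

Definition bounded_on (R : realType) (nu : R) (T : (R[i] -> R[i]) -> (R[i] -> R[i])) : Prop :=
  exists M : R, forall f, in_fock nu f ->
    in_fock nu (T f) /\ fock_norm nu (T f) <= M * fock_norm nu f.

Definition power_bounded (R : realType) (nu : R) (T : (R[i] -> R[i]) -> (R[i] -> R[i])) : Prop :=
  exists M : R, forall (n : nat), (1 <= n)%N -> forall f, in_fock nu f ->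
    fock_norm nu (iter n T f) <= M * fock_norm nu f.

(* Main.v *)
(* Put g(z) = w(z) exp(conj(b) a z).  Since |a| = 1, moving the Gaussian weight
   from z to az + b turns the bound on W applied to the normalized reproducing
   kernels into a bound, uniform in the centre z0, for the Gaussian means of
   |g(. + z0)|^nu.  Averaging the mean value property over rotations of the plane
   then bounds g, so g is constant by Liouville, and W is |w(0)| exp(|b|^2/2)
   times an isometry; its powers are bounded iff this factor is at most 1.

   Only pointwise complex differentiability of entire functions is assumed, so
   the mean value property and Liouville's theorem rest on Goursat's bisection
   argument, applied to functions of log(z - z0) on a rectangle of height 2 pi:
   there the horizontal sides cancel by periodicity, and integrals over vertical
   sides are integrals over circles. *)
Require Import Defs.
From HB Require Import structures.
From mathcomp Require Import all_boot all_order all_algebra.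
From mathcomp Require Import all_classical all_reals all_analysis.
From mathcomp Require Import complex.
From mathcomp Require Import measurable_realfun ring lra.
Import Order.TTheory GRing.Theory Num.Theory.
Import numFieldNormedType.Exports.
Local Open Scope classical_set_scope.
Local Open Scope ring_scope.
Local Open Scope complex_scope.

Set Implicit Arguments.
Unset Strict Implicit.
Unset Printing Implicit Defensive.

Local Notation Re := complex.Re.
Local Notation Im := complex.Im.

(** * Goursat's theorem on rectangles *)

Section Goursat.
Context {R : realType}.
Notation mu := (@lebesgue_measure R).

(** Complex integrals never occur. The integral of F dz is handled through the real form Re F dx -
    Im F dy, mean values are computed for imaginary parts, and real parts follow on replacing F by
    iF. The normalized kernels are the right test functions because their norms do not depend on the
    centre, while their weighted moduli are translates of one Gaussian. Since g only has to be
    bounded, crude inequalities suffice: |g(z0)| is at most twice its mean over a circle, and |g| <=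
    1 + |g|^nu takes the place of a convexity argument. *)

Definition seg_int (f : R -> R) (a b : R) : R := \int[mu]_(x in `[a, b]) f x.

Lemma continuous_seg_integrable (f : R -> R) (a b : R) : continuous f ->
  mu.-integrable `[a, b] (EFin \o f).
Proof.
move=> cf; apply: continuous_compact_integrable; first exact: segment_compact.
exact: continuous_subspaceT.
Qed.

Lemma seg_int_split (f : R -> R) (a c b : R) : continuous f -> a <= c -> c <= b ->
  seg_int f a b = seg_int f a c + seg_int f c b.
Proof.
move=> cf ac cb; apply/eqP; rewrite addrC -subr_eq; apply/eqP.
rewrite /seg_int Rintegral_itvB; first last.
- by rewrite bnd_simp.
- by rewrite bnd_simp.
- exact: continuous_seg_integrable.
rewrite Rintegral_itv_obnd_cbnd//.
apply: integrableS (continuous_seg_integrable c b cf) => //.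
by apply: subset_itvr; rewrite bnd_simp.
Qed.

Lemma seg_int_approx (f : R -> R) (a b k e : R) : continuous f -> a <= b ->
  (forall x, a <= x -> x <= b -> `|f x - k| <= e) ->
  `|seg_int f a b - k * (b - a)| <= e * (b - a).
Proof.
move=> cf ab fk.
have Icst c : \int[mu]_(x in `[a, b]) c = c * (b - a).
  rewrite Rintegral_cst//; congr (_ * _).
  have /(congr1 fine) -> := lebesgue_measure_itv `[a, b].
  rewrite /= lte_fin; case: ltrP => //= ba.
  by have -> : b = a by [apply/eqP; rewrite eq_le ab ba]; rewrite subrr.
have icst c : mu.-integrable `[a, b] (EFin \o cst c).
  by apply: continuous_seg_integrable => x; exact: cvg_cst.
rewrite /seg_int -[k * _]Icst -RintegralB//; [|exact: continuous_seg_integrable|exact: icst].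
rewrite -[e * _]Icst.
have cg : continuous (fun x => f x - k).
  by move=> x; apply: cvgB => //; [exact: cf|exact: cvg_cst].
apply: le_trans (le_normr_Rintegral _ _) _ => //.
  exact: (continuous_seg_integrable _ _ cg).
apply: le_Rintegral => //.
  apply: (@continuous_seg_integrable (fun x => `|f x - k|)).
  by move=> x; apply: cvg_norm; exact: cg.
  exact: icst.
by move=> x /=; rewrite in_itv/= => /andP[? ?]; exact: fk.
Qed.

Lemma seg_intB (f g : R -> R) (a b : R) : continuous f -> continuous g ->
  seg_int (fun x => f x - g x) a b = seg_int f a b - seg_int g a b.
Proof.
move=> cf cg; apply: RintegralB => //.
  exact: (continuous_seg_integrable _ _ cf).
exact: (continuous_seg_integrable _ _ cg).
Qed.

(** The coefficient [q] shared by both expansions says dP/dy = dQ/dx, so P dx + Q dy is closed.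
    Differentiability is pointwise: [d] may depend on [x] and [y], which is the setting of Goursat's
    argument. *)
Definition closed_form (P Q : R -> R -> R) : Prop := forall x y, exists p q r : R,
  forall e, 0 < e -> exists2 d, 0 < d & forall h k, `|h| < d -> `|k| < d ->
    `|P (x + h) (y + k) - P x y - (p * h + q * k)| <= e * (`|h| + `|k|) /\
    `|Q (x + h) (y + k) - Q x y - (q * h + r * k)| <= e * (`|h| + `|k|).

Lemma lipschitz_at_continuous (f : R -> R) (x p : R) :
  (exists2 d, 0 < d & forall h, `|h| < d -> `|f (x + h) - f x - p * h| <= `|h|) ->
  {for x, continuous f}.
Proof.
move=> [d d0 H]; apply/cvgrPdist_le => /= e e0.
have N0 : 0 < 1 + `|p| by rewrite ltr_pwDl.
near=> t.
have td : `|t - x| < Num.min d (e / (1 + `|p|)).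
  near: t.
  have m0 : 0 < Num.min d (e / (1 + `|p|)) by rewrite lt_min d0 divr_gt0.
  exists (Num.min d (e / (1 + `|p|))) => //= t; rewrite distrC.
  exact.
move: td; rewrite lt_min => /andP[td te].
have := H _ td; rewrite [x + _]addrC subrK => Ht.
rewrite distrC -[f t - f x](subrK (p * (t - x))).
apply: le_trans (ler_normD _ _) _.
apply: le_trans (lerD Ht (lexx _)) _.
rewrite normrM -[X in X + _]mul1r -mulrDl mulrC -ler_pdivlMr//.
exact: ltW.
Unshelve. all: by end_near. Qed.

Lemma closed_form_continuous (P Q : R -> R -> R) : closed_form P Q ->
  (forall y, continuous (P ^~ y)) /\ (forall x, continuous (Q x)).
Proof.
move=> cPQ; split=> [y x|x y]; have [p [q [r /(_ 1 ltr01) [d d0 H]]]] := cPQ x y.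
  apply: (@lipschitz_at_continuous _ _ p); exists d => // h hd.
  by have := (H h 0 hd); rewrite normr0 !addr0 mulr0 addr0 mul1r => /(_ d0) [].
apply: (@lipschitz_at_continuous _ _ r); exists d => // h hd.
by have := (H 0 h); rewrite normr0 !addr0 !mulr0 !add0r mul1r => /(_ d0 hd) [].
Qed.

(** The integral of P dx + Q dy along the boundary, counterclockwise. *)
Definition circulation (P Q : R -> R -> R) (x0 x1 y0 y1 : R) : R :=
  seg_int (P ^~ y0) x0 x1 + seg_int (Q x1) y0 y1
  - seg_int (P ^~ y1) x0 x1 - seg_int (Q x0) y0 y1.

Lemma circulation_split (P Q : R -> R -> R) (x0 x x1 y0 y y1 : R) :
  closed_form P Q -> x0 <= x -> x <= x1 -> y0 <= y -> y <= y1 ->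
  circulation P Q x0 x1 y0 y1 =
    circulation P Q x0 x y0 y + circulation P Q x x1 y0 y
    + circulation P Q x0 x y y1 + circulation P Q x x1 y y1.
Proof.
move=> /closed_form_continuous[cP cQ] x0x xx1 y0y yy1; rewrite /circulation.
rewrite (seg_int_split (cP y0) x0x xx1) (seg_int_split (cP y1) x0x xx1).
rewrite (seg_int_split (cQ x0) y0y yy1) (seg_int_split (cQ x1) y0y yy1).
ring.
Qed.

(* The integral of the affine part of the form vanishes by symmetry, so only
   the first-order remainder contributes. *)
Lemma circulation_small (P Q : R -> R -> R) (x y e : R) :
  closed_form P Q -> 0 < e -> exists2 d, 0 < d &
  forall x0 a y0 b, x0 <= x -> x <= x0 + a -> y0 <= y -> y <= y0 + b -> a + b < d ->
  `|circulation P Q x0 (x0 + a) y0 (y0 + b)| <= e * (a + b) ^+ 2.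
Proof.
move=> cPQ e0; have [cP cQ] := closed_form_continuous cPQ.
have [p [q [r H]]] := cPQ x y.
have e20 : 0 < e / 2 by rewrite divr_gt0.
have {H} [d d0 H] := H _ e20.
exists d => // x0 a y0 b x0x xx1 y0y yy1 abd.
have a0 : 0 <= a by lra.
have b0 : 0 <= b by lra.
have near_xy t s : x0 <= t -> t <= x0 + a -> y0 <= s -> s <= y0 + b ->
    `|P t s - P x y - (p * (t - x) + q * (s - y))| <= e / 2 * (a + b) /\
    `|Q t s - Q x y - (q * (t - x) + r * (s - y))| <= e / 2 * (a + b).
  move=> t0 t1 s0 s1.
  have ta : `|t - x| <= a by rewrite ler_norml; apply/andP; split; lra.
  have sb : `|s - y| <= b by rewrite ler_norml; apply/andP; split; lra.
  have [||HP HQ] := H (t - x) (s - y).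
  - by apply: le_lt_trans ta _; lra.
  - by apply: le_lt_trans sb _; lra.
  rewrite ![_ + (_ - _)]addrC !subrK in HP HQ.
  have le : e / 2 * (`|t - x| + `|s - y|) <= e / 2 * (a + b).
    by rewrite ler_pM2l// lerD.
  by split; [exact: le_trans HP le|exact: le_trans HQ le].
have x0a : x0 <= x0 + a by lra.
have y0b : y0 <= y0 + b by lra.
have eab : e * (a + b) = e / 2 * (a + b) + e / 2 * (a + b) by lra.
(* Between the two horizontal sides the affine part of P differs by [- q * b], between the two
   vertical ones that of Q differs by [q * a]. Multiplied by the lengths [a] and [b], these cancel
   in the circulation. Each of two facing sides has error at most [e / 2 * (a + b)]. *)
have HP : `|seg_int (P ^~ y0) x0 (x0 + a) -
    seg_int (P ^~ (y0 + b)) x0 (x0 + a) - (- q * b) * (x0 + a - x0)|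
    <= e * (a + b) * (x0 + a - x0).
  rewrite -seg_intB//; apply: seg_int_approx.
  - by move=> t; apply: cvgB; exact: cP.
  - lra.
  move=> t t0 t1.
  have [H1 _] := near_xy t y0 t0 t1 (lexx _) y0b.
  have [H2 _] := near_xy t (y0 + b) t0 t1 y0b (lexx _).
  rewrite eab; apply: le_trans (lerD H1 H2); rewrite -[X in _ <= _ + X]normrN.
  apply: le_trans (ler_normD _ _); rewrite le_eqVlt; apply/orP; left.
  by apply/eqP; congr (`|_|); ring.
have HQ : `|seg_int (Q (x0 + a)) y0 (y0 + b) -
    seg_int (Q x0) y0 (y0 + b) - (q * a) * (y0 + b - y0)|
    <= e * (a + b) * (y0 + b - y0).
  rewrite -seg_intB//; apply: seg_int_approx.
  - by move=> t; apply: cvgB; exact: cQ.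
  - lra.
  move=> t t0 t1.
  have [_ H1] := near_xy (x0 + a) t x0a (lexx _) t0 t1.
  have [_ H2] := near_xy x0 t (lexx _) x0a t0 t1.
  rewrite eab; apply: le_trans (lerD H1 H2); rewrite -[X in _ <= _ + X]normrN.
  apply: le_trans (ler_normD _ _); rewrite le_eqVlt; apply/orP; left.
  by apply/eqP; congr (`|_|); ring.
have -> : e * (a + b) ^+ 2 = e * (a + b) * (x0 + a - x0) + e * (a + b) * (y0 + b - y0) by ring.
apply: le_trans (lerD HP HQ); apply: le_trans (ler_normD _ _).
by rewrite le_eqVlt; apply/orP; left; apply/eqP; congr (`|_|); rewrite /circulation; ring.
Qed.

Lemma circulation_quarter (P Q : R -> R -> R) (x y a b : R) :
  closed_form P Q -> 0 <= a -> 0 <= b -> exists q : R * R,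
  [/\ x <= q.1, q.1 <= x + a / 2, y <= q.2, q.2 <= y + b / 2 &
   `|circulation P Q x (x + a) y (y + b)| <=
   4 * `|circulation P Q q.1 (q.1 + a / 2) q.2 (q.2 + b / 2)|].
Proof.
move=> cPQ a0 b0.
have halfK (u c : R) : u + c = u + c / 2 + c / 2 by lra.
have E : circulation P Q x (x + a) y (y + b) =
    circulation P Q x (x + a / 2) y (y + b / 2)
    + circulation P Q (x + a / 2) (x + a / 2 + a / 2) y (y + b / 2)
    + circulation P Q x (x + a / 2) (y + b / 2) (y + b / 2 + b / 2)
    + circulation P Q (x + a / 2) (x + a / 2 + a / 2)
        (y + b / 2) (y + b / 2 + b / 2).
  by rewrite (halfK x a) (halfK y b); apply: circulation_split => //; lra.
apply: contrapT => H.
have small (q : R * R) : x <= q.1 -> q.1 <= x + a / 2 -> y <= q.2 ->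
    q.2 <= y + b / 2 ->
    4 * `|circulation P Q q.1 (q.1 + a / 2) q.2 (q.2 + b / 2)| <
    `|circulation P Q x (x + a) y (y + b)|.
  by move=> *; rewrite ltNge; apply/negP => ?; apply: H; exists q.
have xa : x <= x + a / 2 by lra.
have yb : y <= y + b / 2 by lra.
have H1 := small (x, y) (lexx _) xa (lexx _) yb.
have H2 := small (x + a / 2, y) xa (lexx _) (lexx _) yb.
have H3 := small (x, y + b / 2) (lexx _) xa yb (lexx _).
have H4 := small (x + a / 2, y + b / 2) xa (lexx _) yb (lexx _).
move: H1 H2 H3 H4; rewrite /= E.
set c1 := circulation _ _ _ _ _ _; set c2 := circulation _ _ _ _ _ _.
set c3 := circulation _ _ _ _ _ _; set c4 := circulation _ _ _ _ _ _.
have := ler_normD (c1 + c2 + c3) c4; have := ler_normD (c1 + c2) c3.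
have := ler_normD c1 c2; lra.
Qed.

(** The common point is the supremum of the left endpoints, since every right endpoint bounds all of
    them from above. *)
Lemma nested_intervals (x : R ^nat) (l : R ^nat) :
  (forall n, x n <= x n.+1) -> (forall n, x n.+1 + l n.+1 <= x n + l n) ->
  (forall n, 0 <= l n) -> exists z, forall n, x n <= z /\ z <= x n + l n.
Proof.
move=> x_nd xl_ni l0.
have ndx : {homo x : m n / (m <= n)%N >-> m <= n}.
  by apply: homo_leq => // y z t; exact: le_trans.
have nix : {homo (fun n => x n + l n) : m n / (m <= n)%N >-> n <= m}.
  by apply: homo_leq => // y z t yz /le_trans; exact.
have ub m : ubound (range x) (x m + l m).
  move=> _ [k _ <-]; have [mk|/ltnW km] := leqP m k.
    by apply: le_trans (nix _ _ mk); rewrite lerDl.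
  by apply: le_trans (ndx _ _ km) _; rewrite lerDl.
exists (sup (range x)) => n; split.
  apply: ub_le_sup; last by exists n.
  by exists (x 0%N + l 0%N); exact: ub.
by apply: ge_sup; [exists (x 0%N), 0%N|exact: ub].
Qed.

(** Each bisection loses at most a factor 4. Near the limit point the circulation is at most [e]
    times the square of half the perimeter, and this square also shrinks by 4 at each step. The two
    rates compensate, leaving [|K| <= e * (a + b) ^+ 2] for every [e]. *)
Theorem circulation_closed (P Q : R -> R -> R) (x y a b : R) :
  closed_form P Q -> 0 <= a -> 0 <= b ->
  circulation P Q x (x + a) y (y + b) = 0.
Proof.
move=> cPQ a0 b0; set K := circulation _ _ _ _ _ _.
apply/eqP; rewrite -normr_le0 leNgt; apply/negP => K0.
pose s n : R := 2^-1 ^+ n.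
have sS n : s n.+1 = s n / 2 by rewrite /s exprS mulrC.
have s0 n : 0 <= s n by rewrite /s exprn_ge0// invr_ge0.
pose C (n : nat) (p : R * R) :=
  circulation P Q p.1 (p.1 + a * s n) p.2 (p.2 + b * s n).
pose good (np : nat * (R * R)) (q : R * R) :=
  [/\ np.2.1 <= q.1, q.1 <= np.2.1 + a * s np.1.+1,
      np.2.2 <= q.2, q.2 <= np.2.2 + b * s np.1.+1 &
      `|C np.1 np.2| <= 4 * `|C np.1.+1 q|].
have [f Hf] : {f : nat * (R * R) -> R * R & forall np, good np (f np)}.
  apply: choice => -[n p]; rewrite /good /C /= sS !mulrA.
  by apply: circulation_quarter => //; exact: mulr_ge0.
pose p := fix p n := if n is m.+1 then f (m, p m) else (x, y).
have pS n : p n.+1 = f (n, p n) by [].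
have [z1 Hz1] : exists z, forall n, (p n).1 <= z /\ z <= (p n).1 + a * s n.
  apply: (@nested_intervals (fun n => (p n).1) (fun n => a * s n)) => n.
  - by rewrite pS; case: (Hf (n, p n)).
  - by rewrite pS; case: (Hf (n, p n)) => /=; rewrite sS => *; lra.
  - by rewrite mulr_ge0.
have [z2 Hz2] : exists z, forall n, (p n).2 <= z /\ z <= (p n).2 + b * s n.
  apply: (@nested_intervals (fun n => (p n).2) (fun n => b * s n)) => n.
  - by rewrite pS; case: (Hf (n, p n)).
  - by rewrite pS; case: (Hf (n, p n)) => /=; rewrite sS => *; lra.
  - by rewrite mulr_ge0.
have KC n : `|K| <= 4 ^+ n * `|C n (p n)|.
  elim: n => [|n IH].
    by rewrite expr0 mul1r /C /s expr0 !mulr1 /= /K.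
  apply: le_trans IH _; rewrite exprSr -mulrA ler_pM2l ?exprn_gt0// pS.
  by case: (Hf (n, p n)).
have ab0 : 0 < 2 * ((a + b) ^+ 2 + 1).
  by rewrite mulr_gt0// ltr_wpDl// sqr_ge0.
(* Chosen so that [e * (a + b) ^+ 2 < |K|]; the [+ 1] keeps the denominator positive for a rectangle
   reduced to a point. *)
pose e := `|K| / (2 * ((a + b) ^+ 2 + 1)).
have e0 : 0 < e by rewrite divr_gt0.
have [d d0 Hd] := circulation_small z1 z2 cPQ e0.
have [n nd] : exists n, (a + b) * s n < d.
  have : (fun n => (a + b) * s n) @ \oo --> (a + b) * 0.
    by apply: cvgMl_tmp; apply: cvg_expr; rewrite ger0_norm; lra.
  rewrite mulr0 => /cvgrPdist_lt /(_ _ d0) [N _ /(_ N (leqnn N))].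
  rewrite /= sub0r normrN => H; exists N.
  by apply: le_lt_trans H; exact: ler_norm.
have [z1l z1r] := Hz1 n; have [z2l z2r] := Hz2 n.
have abn : a * s n + b * s n < d by rewrite -mulrDl.
have := Hd _ _ _ _ z1l z1r z2l z2r abn.
rewrite -/(C n (p n)) -mulrDl exprMn.
have sn4 : 4 ^+ n * s n ^+ 2 = 1.
  rewrite /s -exprM mulnC exprM -exprMn.
  by rewrite (_ : 4 * 2^-1 ^+ 2 = 1) ?expr1n//; lra.
have p4 : 0 < 4 ^+ n :> R by rewrite exprn_gt0.
rewrite -(ler_pM2l p4) => /(le_trans (KC n)).
have -> : 4 ^+ n * (e * ((a + b) ^+ 2 * s n ^+ 2)) =
    e * (a + b) ^+ 2 * (4 ^+ n * s n ^+ 2) by ring.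
rewrite sn4 mulr1 leNgt => /negP; apply.
have -> : `|K| = e * (2 * ((a + b) ^+ 2 + 1)) by rewrite /e divfK// gt_eqF.
by rewrite ltr_pM2l//; have := sqr_ge0 (a + b); lra.
Qed.
End Goursat.

(** * Complex differentiability and the exponential *)

Section ComplexDifferentiability.
Context {R : realType}.
Implicit Types (z h l : R[i]) (f g : R[i] -> R[i]).

Lemma normr_cabs z : `|z| = (cabs z)%:C.
Proof. by []. Qed.

Lemma cabs_ge0 z : 0 <= cabs z.
Proof. by rewrite -ler0c -normr_cabs. Qed.

Lemma cabsM z z' : cabs (z * z') = cabs z * cabs z'.
Proof. exact: Normc.normcM. Qed.

Lemma cabs_triangle z z' : cabs (z + z') <= cabs z + cabs z'.
Proof. exact: le_normcD. Qed.

Lemma cabsN z : cabs (- z) = cabs z.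
Proof. exact: normcN. Qed.

Lemma cabsE (x y : R) : cabs (x +i* y) = Num.sqrt (x ^+ 2 + y ^+ 2).
Proof. by []. Qed.

Lemma cabs_sqr z : cabs z ^+ 2 = Re z ^+ 2 + Im z ^+ 2.
Proof. by case: z => x y; rewrite cabsE sqr_sqrtr// addr_ge0// sqr_ge0. Qed.

Lemma Re_le_cabs z : `|Re z| <= cabs z.
Proof. by rewrite -lecR; exact: normc_ge_Re. Qed.

Lemma Im_le_cabs z : `|Im z| <= cabs z.
Proof.
case: z => x y; rewrite cabsE -sqrtr_sqr; apply: ler_wsqrtr.
by rewrite lerDr sqr_ge0.
Qed.

Lemma cabs_le_ReIm z : cabs z <= `|Re z| + `|Im z|.
Proof.
case: z => x y; have -> : x +i* y = x%:C + 0 +i* y by simpc.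
apply: le_trans (cabs_triangle _ _) _.
by rewrite !cabsE expr0n/= addr0 add0r !sqrtr_sqr addr0 add0r.
Qed.

(** Complex differentiability with real bounds: the norm of [R[i]] takes its values in [R[i]], and
    [entireP] translates between the two forms. *)
Definition cdiff_at f z l := forall e : R, 0 < e -> exists2 d, 0 < d &
  forall h, cabs h < d -> cabs (f (z + h) - f z - l * h) <= e * cabs h.

(** [K] is arbitrary in order to serve both [R[i]], in [entireP], and [R], for the real functions
    that make up [cexp]. *)
Lemma derivable_littleo (K : numFieldType) (f : K^o -> K^o) (x : K) :
  derivable f x 1 -> forall e : K, 0 < e -> exists2 d : K, 0 < d &
    forall h : K, `|h| < d -> `|f (x + h) - f x - 'D_1 f x * h| <= e * `|h|.
Proof.
move=> /derivable_nbhs/eqaddoP H e e0.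
have [d d0 Hd] := H e e0; exists d => // h hd.
have : ball (0 : K^o) d h by rewrite /ball/= sub0r normrN.
move=> /Hd /=; rewrite /shift/= !fctE /=.
by rewrite [h%:A]mulr1 [h + x]addrC [h *: _]mulrC opprD addrA.
Qed.

Lemma littleo_is_derive (K : numFieldType) (f : K^o -> K^o) (x l : K) :
  (forall e : K, 0 < e -> exists2 d : K, 0 < d &
    forall h : K, `|h| < d -> `|f (x + h) - f x - l * h| <= e * `|h|) ->
  is_derive (x : K^o) (1 : K^o) f l.
Proof.
move=> H.
have cvgl : (fun h : K => h^-1 *: ((f \o shift x) (h *: (1 : K^o)) - f x)) @ 0^' --> (l : K^o).
  apply/cvgrPdist_le => /= e e0.
  have [d d0 Hd] := H e e0.
  exists d => // h /=; rewrite sub0r normrN => hd h0.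
  have -> : l - h^-1 *: (f (h *: (1 : K^o) + x) - f x) =
      - (h^-1 * (f (x + h) - f x - l * h)).
    by rewrite [h *: _]mulr1 [h + x]addrC [_ *: _]mulrC; field.
  rewrite normrN normrM normfV ler_pdivrMl ?normr_gt0// [X in _ <= X]mulrC.
  exact: Hd.
apply: DeriveDef; first by apply/cvg_ex; exists l.
exact: cvg_lim.
Qed.

Lemma entireP f : entire f <-> forall z, exists l, cdiff_at f z l.
Proof.
split=> [ef z|H z].
  exists ('D_1 (f : R[i]^o -> R[i]^o) z) => e e0.
  have [|d d0 Hd] := derivable_littleo (ef z) (e := e%:C).
    by rewrite ltcR.
  have dR : d = (Re d)%:C by apply/esym/RRe_real; exact: gtr0_real.
  exists (Re d); first by rewrite -ltcR -dR.
  move=> h; rewrite -ltcR -dR -normr_cabs => /Hd.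
  by rewrite !normr_cabs -rmorphM/= lecR.
have [l Hl] := H z.
suff [] : is_derive (z : R[i]^o) (1 : R[i]^o) (f : R[i]^o -> R[i]^o) l by [].
apply: littleo_is_derive => e e0.
have eR : e = (Re e)%:C by apply/esym/RRe_real; exact: gtr0_real.
have [|d d0 Hd] := Hl (Re e); first by rewrite -ltcR -eR.
exists d%:C; first by rewrite ltcR.
move=> h; rewrite !normr_cabs ltcR => /Hd.
by rewrite {2}eR -rmorphM/= lecR.
Qed.

Lemma entire_cst (c : R[i]) : entire (fun=> c).
Proof. by move=> z; exact: derivable_cst. Qed.

Lemma entire_id : entire (@id R[i]).
Proof. by move=> z; exact: derivable_id. Qed.

Lemma entireD f g : entire f -> entire g -> entire (fun z => f z + g z).
Proof. by move=> ef eg z; exact: derivableD. Qed.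

Lemma entire_opp : entire (fun z : R[i] => - z).
Proof. by move=> z; apply: derivableN; exact: derivable_id. Qed.

Lemma entireM f g : entire f -> entire g -> entire (fun z => f z * g z).
Proof. by move=> ef eg z; exact: derivableM. Qed.

Lemma entireZ (c : R[i]) f : entire f -> entire (fun z => c * f z).
Proof. by move=> ef; apply: entireM; [exact: entire_cst|exact: ef]. Qed.

Lemma entire_comp f g : entire f -> entire g -> entire (fun z => f (g z)).
Proof.
move=> ef eg z; apply/derivable1_diffP.
apply: (@differentiable_comp _ _ _ _ (g : R[i]^o -> R[i]^o) (f : R[i]^o -> R[i]^o)).
  by apply/derivable1_diffP.
by apply/derivable1_diffP.
Qed.

Definition cexp z : R[i] :=
  (expR (Re z) * cos (Im z)) +i* (expR (Re z) * sin (Im z)).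

Lemma cexpD z z' : cexp (z + z') = cexp z * cexp z'.
Proof.
case: z => a b; case: z' => c d; rewrite /cexp; simpc.
by rewrite /= expRD cosD sinD; congr Complex; ring.
Qed.

Lemma cexp0 : cexp 0 = 1.
Proof. by rewrite /cexp /= expR0 cos0 sin0 !mul1r. Qed.

Lemma cabs_cexp z : cabs (cexp z) = expR (Re z).
Proof.
rewrite cabsE !exprMn -mulrDr cos2Dsin2 mulr1 sqrtr_sqr.
by rewrite ger0_norm// expR_ge0.
Qed.

Lemma cexpN z : cexp z * cexp (- z) = 1.
Proof. by rewrite -cexpD subrr cexp0. Qed.

Lemma cexp_2pi s : cexp (s +i* (2 * pi)) = cexp s%:C.
Proof. by rewrite /cexp/= mulr_natl cos2pi sin2pi cos0 sin0. Qed.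

Lemma cexp_diff0 : cdiff_at cexp 0 1.
Proof.
(* With [e <= 1] the factors met below are bounded by constants, such as [1 + |x| <= 2]. The 7 adds
   the errors 3 and 4 of the real and imaginary parts. *)
suff H (e : R) : 0 < e -> e <= 1 -> exists2 d, 0 < d &
    forall h, cabs h < d -> cabs (cexp (0 + h) - cexp 0 - 1 * h) <= 7 * e * cabs h.
  move=> e e0; have m0 : 0 < Num.min (e / 7) 1 by rewrite lt_min ltr01 andbT; lra.
  have [|d d0 Hd] := H _ m0; first by rewrite ge_min lexx orbT.
  exists d => // h /Hd /le_trans; apply; apply: ler_wpM2r; first exact: cabs_ge0.
  have : Num.min (e / 7) 1 <= e / 7 by rewrite ge_min lexx.
  by lra.
move=> e0 e1.
have dE : is_derive (0 : R) (1 : R) expR (expR 0) by exact: is_derive_expR.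
have dC : is_derive (0 : R) (1 : R) cos (- sin 0) by exact: is_derive_cos.
have dS : is_derive (0 : R) (1 : R) sin (cos 0) by exact: is_derive_sin.
have [d1 d10 H1] := derivable_littleo (@ex_derive _ _ _ _ _ _ _ dE) e0.
have [d2 d20 H2] := derivable_littleo (@ex_derive _ _ _ _ _ _ _ dC) e0.
have [d3 d30 H3] := derivable_littleo (@ex_derive _ _ _ _ _ _ _ dS) e0.
rewrite (@derive_val _ _ _ _ _ _ _ dE) in H1.
rewrite (@derive_val _ _ _ _ _ _ _ dC) in H2.
rewrite (@derive_val _ _ _ _ _ _ _ dS) in H3.
exists (Num.min (Num.min d1 d2) (Num.min d3 e)).
  by rewrite !lt_min d10 d20 d30 e0.
case=> x y; rewrite !lt_min => /andP[/andP[h1 h2] /andP[h3 he]].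
have xh : `|x| <= cabs (x +i* y) := Re_le_cabs (x +i* y).
have yh : `|y| <= cabs (x +i* y) := Im_le_cabs (x +i* y).
have := H1 _ (le_lt_trans xh h1); have := H2 _ (le_lt_trans yh h2).
have := H3 _ (le_lt_trans yh h3).
rewrite !add0r cexp0 expR0 cos0 sin0 subr0 oppr0 mul0r subr0 !mul1r => Hs Hc He.
apply: le_trans (cabs_le_ReIm _) _.
set r := cabs _ in h1 h2 h3 he xh yh *.
have ye : `|y| <= e by apply: le_trans yh _; exact: ltW.
have xe : `|x| <= e by apply: le_trans xh _; exact: ltW.
have c1 : `|cos y| <= 1 by rewrite ler_norml cos_geN1 cos_le1.
have s1 : `|sin y| <= 1 by rewrite ler_norml sin_geN1 sin_le1.
have r0 : 0 <= r by exact: cabs_ge0.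
have exr : e * `|x| <= e * r by rewrite ler_pM2l.
have eyr : e * `|y| <= e * r by rewrite ler_pM2l.
have sy : `|sin y| <= 2 * r.
  rewrite -[sin y](subrK y); apply: le_trans (ler_normD _ _) _.
  apply: le_trans (lerD Hs (lexx _)) _.
  have : e * r <= 1 * r by exact: ler_wpM2r.
  by lra.
have HRe : `|expR x * cos y - 1 - x| <= 3 * e * r.
  have -> : expR x * cos y - 1 - x =
    (expR x - 1 - x) * cos y + (1 + x) * (cos y - 1) by ring.
  apply: le_trans (ler_normD _ _) _; rewrite !normrM.
  have -> : 3 * e * r = e * r * 1 + 2 * (e * r) by ring.
  apply: lerD; apply: ler_pM => //; [by lra| |by lra].
  by apply: le_trans (ler_normD _ _) _; rewrite normr1; lra.
have HIm : `|expR x * sin y - 0 - y| <= 4 * e * r.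
  have -> : expR x * sin y - 0 - y =
    (expR x - 1 - x) * sin y + x * sin y + (sin y - y) by ring.
  apply: le_trans (ler_normD _ _) _.
  apply: le_trans (lerD (ler_normD _ _) (lexx _)) _; rewrite !normrM.
  have -> : 4 * e * r = e * r * 1 + e * (2 * r) + e * r by ring.
  apply: lerD; last by lra.
  by apply: lerD; apply: ler_pM => //; lra.
have -> : 7 * e * r = 3 * e * r + 4 * e * r by ring.
exact: lerD.
Qed.

Lemma entire_cexp : entire cexp.
Proof.
apply/entireP => z; exists (cexp z) => e e0.
have E0 : 0 < e / expR (Re z) by rewrite divr_gt0// expR_gt0.
have [d d0 H] := cexp_diff0 E0; exists d => // h /H.
have -> : cexp (z + h) - cexp z - cexp z * h =
    cexp z * (cexp (0 + h) - cexp 0 - 1 * h).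
  by rewrite add0r cexpD cexp0; ring.
by rewrite cabsM cabs_cexp mulrAC ler_pdivlMr ?expR_gt0// [X in X <= _ -> _]mulrC.
Qed.

End ComplexDifferentiability.

(** * Mean value property and Liouville's theorem *)

Section Liouville.
Context {R : realType}.
Implicit Types (z l : R[i]) (f g F : R[i] -> R[i]).

(** This form is the real part of F dz; the Cauchy-Riemann equations supply the shared coefficient
    [- li]. *)
Lemma closed_form_entire F : entire F ->
  closed_form (fun x y => Re (F (x +i* y))) (fun x y => - Im (F (x +i* y))).
Proof.
move=> /entireP eF x y; have [[lr li] Hl] := eF (x +i* y).
exists lr, (- li), (- lr) => e e0; have [d d0 Hd] := Hl e e0.
exists (d / 2) => [|h k hd kd]; first by rewrite divr_gt0.
have hk : cabs (h +i* k) <= `|h| + `|k| := cabs_le_ReIm (h +i* k).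
have /Hd {}Hd : cabs (h +i* k) < d by apply: le_lt_trans hk _; lra.
have {}Hd := le_trans Hd (ler_wpM2l (ltW e0) hk).
have zhE : (x +i* y) + (h +i* k) = (x + h) +i* (y + k) by simpc.
move: Hd; rewrite zhE; case: (F (x +i* y)) => a b.
case: (F ((x + h) +i* (y + k))) => c d'; simpc => Hd /=.
split.
  apply: le_trans Hd; apply: le_trans (Re_le_cabs _) => /=.
  by rewrite le_eqVlt; apply/orP; left; apply/eqP; congr (`|_|); ring.
apply: le_trans Hd; apply: le_trans (Im_le_cabs _) => /=.
rewrite -[X in _ <= X]normrN.
by rewrite le_eqVlt; apply/orP; left; apply/eqP; congr (`|_|); ring.
Qed.

Lemma continuous_Im_entire F s : entire F -> continuous (fun y => Im (F (s +i* y))).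
Proof.
move=> /closed_form_entire/closed_form_continuous[_ /(_ s) c] y.
have -> : (fun y => Im (F (s +i* y))) = (fun y => - - Im (F (s +i* y))).
  by apply/funext => t; rewrite opprK.
by apply: cvgN; exact: c.
Qed.

Lemma continuous_Re_entire F (s : R) : entire F -> continuous (fun y => Re (F (s +i* y))).
Proof.
move=> eF.
have -> : (fun y => Re (F (s +i* y))) = (fun y => Im ('i * F (s +i* y))).
  by apply/funext => y; case: (F _) => a b; simpc.
apply: (@continuous_Im_entire (fun z => 'i * F z)).
exact: entireZ.
Qed.

Lemma pi2_ge0 : 0 <= 2 * pi :> R.
Proof. by rewrite mulr_ge0// pi_ge0. Qed.

(* On [s, t] x [0, 2 pi] the horizontal sides cancel by periodicity. *)
Lemma periodic_mean_cst F (s t : R) : entire F ->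
  (forall x, F (x +i* (2 * pi)) = F (x%:C)) -> s <= t ->
  seg_int (fun y => Im (F (s +i* y))) 0 (2 * pi) =
  seg_int (fun y => Im (F (t +i* y))) 0 (2 * pi).
Proof.
move=> eF per st.
have ts : 0 <= t - s by rewrite subr_ge0.
have := circulation_closed s 0 (closed_form_entire eF) ts pi2_ge0.
rewrite /circulation add0r [s + _]addrC subrK.
rewrite (_ : (fun x => Re (F (x +i* (2 * pi)))) = (fun x => Re (F (x +i* 0)))); last first.
  by apply/funext => x; rewrite per.
have intN (G : R -> R) : continuous G ->
    seg_int (fun y => - G y) 0 (2 * pi) = - seg_int G 0 (2 * pi).
  move=> cG; have cGG : continuous (fun y => G y - G y).
    by move=> y; apply: cvgB; exact: cG.
  have := seg_intB 0 (2 * pi) cGG cG; rewrite (seg_intB _ _ cG cG) subrr sub0r => <-.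
  by congr seg_int; apply/funext => y; rewrite subrr sub0r.
rewrite !intN; [|exact: continuous_Im_entire..].
by set a := seg_int _ _ _; set b := seg_int _ _ _; set c := seg_int _ _ _; lra.
Qed.

(** By [periodic_mean_cst] the integral does not change when [s] decreases, so it equals its limit
    at minus infinity, where the circles shrink to their centre. *)
Lemma mean_Im_limit F l (s : R) : entire F ->
  (forall x, F (x +i* (2 * pi)) = F (x%:C)) ->
  (forall e, 0 < e -> exists s0 : R, forall t y, t <= s0 ->
     cabs (F (t +i* y) - l) <= e) ->
  seg_int (fun y => Im (F (s +i* y))) 0 (2 * pi) = Im l * (2 * pi).
Proof.
move=> eF per lim; apply/eqP; rewrite -subr_eq0 -normr_le0.
apply/ler_addgt0Pl => e e0; rewrite addr0.
have p0 : 0 < 2 * pi :> R by rewrite mulr_gt0// pi_gt0.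
have [s0 Hs0] := lim (e / (2 * pi)) (divr_gt0 e0 p0).
rewrite -(@periodic_mean_cst _ (Num.min s s0) s) ?ge_min ?lexx//.
have := @seg_int_approx R (fun y => Im (F (Num.min s s0 +i* y))) 0 (2 * pi) (Im l) (e / (2 * pi)).
rewrite subr0 divfK ?gt_eqF//; apply => //; first exact: continuous_Im_entire.
  exact: ltW.
move=> y _ _; have := Hs0 (Num.min s s0) y; rewrite ge_min lexx orbT => /(_ isT).
apply: le_trans; apply: le_trans (Im_le_cabs _).
by case: (F _) => a b; case: l {Hs0 lim} => c d.
Qed.

Lemma entire_lipschitz_at g z : entire g -> exists2 C, 0 < C &
  exists2 d, 0 < d & forall h, cabs h < d -> cabs (g (z + h) - g z) <= C * cabs h.
Proof.
move=> /entireP/(_ z)[l /(_ 1 ltr01)[d d0 Hd]].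
exists (1 + cabs l); first by rewrite ltr_pwDl// cabs_ge0.
exists d => // h /Hd H; rewrite -[_ - _](subrK (l * h)).
apply: le_trans (cabs_triangle _ _) _.
by rewrite cabsM mulrDl lerD2r.
Qed.

Lemma cexp_small (d : R) : 0 < d -> exists s0 : R, forall t y, t <= s0 ->
  cabs (cexp (t +i* y)) <= d.
Proof.
move=> d0; exists (ln d) => t y tl; rewrite cabs_cexp /= -[leRHS]lnK//.
by rewrite ler_expR.
Qed.

(** The function [g (z0 + z * cexp w)] of [w] is entire, 2 pi i-periodic, and tends to [g z0] as the
    real part of [w] goes to minus infinity. The real part 0 gives the circle through [z0 + z]. *)
Lemma mean_value_Im g z0 z : entire g ->
  seg_int (fun y => Im (g (z0 + z * cexp (0 +i* y)))) 0 (2 * pi) = Im (g z0) * (2 * pi).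
Proof.
move=> eg; apply: (@mean_Im_limit (fun w => g (z0 + z * cexp w))).
- apply: (entire_comp eg); apply: entireD; first exact: entire_cst.
  exact/entireZ/entire_cexp.
- by move=> x; rewrite cexp_2pi.
move=> e e0; have [C C0 [d d0 H]] := entire_lipschitz_at z0 eg.
have z1 : 0 < 1 + cabs z by rewrite ltr_pwDl// cabs_ge0.
pose m := Num.min (d / 2) (e / C).
have m0 : 0 < m by rewrite lt_min !divr_gt0.
have [s0 Hs0] := cexp_small (divr_gt0 m0 z1).
exists s0 => t y ts.
have zm : cabs (z * cexp (t +i* y)) <= m.
  rewrite cabsM; have := Hs0 t y ts; rewrite ler_pdivlMr// mulrC.
  apply: le_trans; apply: ler_wpM2r; first exact: cabs_ge0.
  by rewrite lerDr.
apply: le_trans (H _ _) _.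
  apply: le_lt_trans zm _; rewrite /m gt_min; apply/orP; left; lra.
rewrite mulrC -ler_pdivlMr//; apply: le_trans zm _.
by rewrite /m ge_min lexx orbT.
Qed.

Lemma mean_value_Re g z0 z : entire g ->
  seg_int (fun y => Re (g (z0 + z * cexp (0 +i* y)))) 0 (2 * pi) = Re (g z0) * (2 * pi).
Proof.
move=> eg; have ReE w : Re w = Im ('i * w) by case: w => a b; simpc.
rewrite ReE -(@mean_value_Im (fun z => 'i * g z) _ z).
  by congr seg_int; apply/funext => y; exact: ReE.
exact: entireZ.
Qed.

(** The difference quotient of [g] at [z0], with increment [cexp w], has the same mean on all
    circles. Small circles give the value [l]; on the circle of radius [expR s] the quotient is at
    most [2 * C / expR s], hence arbitrarily small. *)
Lemma bounded_entire_Im_diff g C z0 l : entire g -> (forall z, cabs (g z) <= C) ->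
  cdiff_at g z0 l -> Im l = 0.
Proof.
move=> eg gC gl.
have C0 : 0 <= C by apply: le_trans (gC 0); exact: cabs_ge0.
pose F w := (g (z0 + cexp w) - g z0) * cexp (- w).
have eF : entire F.
  apply: entireM.
    apply: entireD; last exact: entire_cst.
    apply: (entire_comp eg); apply: entireD; first exact: entire_cst.
    exact: entire_cexp.
  exact: (entire_comp entire_cexp entire_opp).
have cexpN_inv w : cexp (- w) = (cexp w)^-1.
  apply: (@mulfI _ (cexp w)); last first.
    rewrite cexpN divff//; apply/eqP => c0.
    by have := cexpN w; rewrite c0 mul0r => /eqP; rewrite eq_sym oner_eq0.
  apply/eqP => c0.
  by have := cexpN w; rewrite c0 mul0r => /eqP; rewrite eq_sym oner_eq0.
have FE s : seg_int (fun y => Im (F (s +i* y))) 0 (2 * pi) = Im l * (2 * pi).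
  apply: (mean_Im_limit s eF).
    by move=> x; rewrite /F !cexpN_inv cexp_2pi.
  move=> e e0; have [d d0 Hd] := gl e e0.
  have [|s0 Hs0] := cexp_small (d := d / 2); first by rewrite divr_gt0.
  exists s0 => t y ts; rewrite /F.
  set w := t +i* y.
  have -> : (g (z0 + cexp w) - g z0) * cexp (- w) - l =
    (g (z0 + cexp w) - g z0 - l * cexp w) * cexp (- w).
    by rewrite [RHS]mulrBl -[l * _ * _]mulrA cexpN mulr1.
  have wd : cabs (cexp w) < d by apply: le_lt_trans (Hs0 t y ts) _; lra.
  rewrite cabsM; apply: le_trans (ler_wpM2r (cabs_ge0 _) (Hd _ wd)) _.
  rewrite -mulrA -cabsM cexpN.
  by rewrite (_ : cabs 1 = 1) ?mulr1//; exact: Normc.normc1.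
apply/eqP; rewrite -normr_le0; apply/ler_addgt0Pl => e e0; rewrite addr0.
have p0 : 0 < 2 * pi :> R by rewrite mulr_gt0// pi_gt0.
rewrite -(ler_pM2r p0) -{1}(gtr0_norm p0) -normrM.
(* At this radius [2 * C / expR s] is at most [e]; the [+ 1] keeps the argument of [ln] positive
   when [C] is 0. *)
pose s := ln ((2 * C + 1) / e).
have C1 : 0 < 2 * C + 1 by rewrite ltr_wpDl// mulr_ge0.
rewrite -(FE s).
have := @seg_int_approx R (fun y => Im (F (s +i* y))) 0 (2 * pi) 0 e.
rewrite mul0r !subr0; apply; first exact: continuous_Im_entire.
  exact: pi2_ge0.
move=> y _ _; rewrite subr0; apply: le_trans (Im_le_cabs _) _.
rewrite /F cabsM cabs_cexp /= expRN /s lnK ?invf_div; last by rewrite posrE divr_gt0.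
rewrite mulrA ler_pdivrMr// mulrC ler_pM2l//.
apply: le_trans (cabs_triangle _ _) _; rewrite cabsN.
by have := gC (z0 + cexp (s +i* y)); have := gC z0; rewrite /s; lra.
Qed.

Theorem Liouville g C : entire g -> (forall z, cabs (g z) <= C) ->
  forall z, g z = g 0.
Proof.
move=> eg gC z.
suff H f : entire f -> (forall z, cabs (f z) <= C) -> Im (f z) = Im (f 0).
  have ReE w : Re w = Im ('i * w) by case: w => a b; simpc.
  have ImE := H _ eg gC.
  have : Re (g z) = Re (g 0).
    rewrite !ReE; apply: (H (fun z => 'i * g z)).
      exact: entireZ.
    by move=> w; rewrite cabsM cabsE expr0n expr1n add0r sqrtr1 mul1r.
  by move: ImE; case: (g z) => a b; case: (g 0) => c d /= -> ->.
move=> {eg gC g} ef fC.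
have z1 : 0 < 1 + cabs z by rewrite ltr_pwDl// cabs_ge0.
(* Restricted to the line through 0 and [z], the imaginary part is a real function whose derivative
   vanishes because the complex derivative does. *)
have := @is_derive_0_is_cst R (fun t => Im (f (t%:C * z))) 1 0.
rewrite mul1r mul0r; apply => t.
apply: littleo_is_derive => e e0.
have /entireP/(_ (t%:C * z)) [l fl] := ef.
have [d d0 Hd] := fl _ (divr_gt0 e0 z1).
exists (d / (1 + cabs z)) => [|h]; first by rewrite divr_gt0.
rewrite ltr_pdivlMr// => hd; rewrite mul0r subr0.
have hz : cabs (h%:C * z) <= `|h| * (1 + cabs z).
  rewrite cabsM cabsE expr0n addr0 sqrtr_sqr ler_wpM2l//.
  by rewrite lerDr.
have := Hd _ (le_lt_trans hz hd).
have Iml : Im l = 0 := bounded_entire_Im_diff ef fC fl.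
have Rel : Re l = 0.
  have ReE w : Re w = Im ('i * w) by case: w => a b; simpc.
  rewrite ReE; apply: (@bounded_entire_Im_diff (fun z => 'i * f z) C (t%:C * z)).
  - exact: entireZ.
  - by move=> w; rewrite cabsM cabsE expr0n expr1n add0r sqrtr1 mul1r.
  move=> e' e'0; have [d' d'0 Hd'] := fl _ e'0; exists d' => // k /Hd'.
  by rewrite -mulrBr -mulrA -mulrBr cabsM cabsE expr0n expr1n add0r sqrtr1 mul1r.
have -> : l = 0 by case: l Iml Rel {fl Hd} => a b /= -> ->.
rewrite mul0r subr0 rmorphD/= mulrDl => H.
have -> : Im (f (t%:C * z + h%:C * z)) - Im (f (t%:C * z)) =
    Im (f (t%:C * z + h%:C * z) - f (t%:C * z)).
  by case: (f _) => a b; case: (f _).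
apply: le_trans (Im_le_cabs _) _; apply: le_trans H _.
apply: le_trans (ler_wpM2l _ hz) _; first by rewrite divr_ge0// ltW.
by rewrite mulrCA divfK ?gt_eqF// mulrC.
Qed.
End Liouville.

(** * Lebesgue measure on the plane *)

Section PlaneMeasure.
Context {R : realType}.
Notation mu := (@lebesgue_measure R).
Notation mu2 := (mu \x mu)%E.

Import HBSimple.

(** Replacing [x] by a simple function [s n x] cuts the domain into finitely many slabs, on each of
    which the function is some [f r] of the second coordinate. Continuity in [x] carries
    measurability to the limit. This gives joint measurability from the separate continuity known
    for entire functions. *)
Lemma caratheodory_measurable d (T : measurableType d) (f : R -> T -> R) :
  (forall t, continuous (f ^~ t)) -> (forall x, measurable_fun setT (f x)) ->
  measurable_fun setT (fun p : R * T => f p.1 p.2).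
Proof.
move=> cf mf.
have mE : measurable_fun [set: R] (EFin \o @id R).
  by apply/measurable_EFinP; exact: measurable_id.
have [s Hs] := approximation_sfun measurableT mE.
apply: (@measurable_fun_cvg _ _ _ _ (fun n p => f (s n p.1) p.2)); last first.
  move=> [x t] _ /=; apply: (cvg_comp (fun n => s n x) (f ^~ t)); last exact: cf.
  by have /fine_cvgP[] := Hs x I.
move=> n _ B mB; rewrite setTI.
have -> : (fun p : R * T => f (s n p.1) p.2) @^-1` B =
    \bigcup_(r in range (s n)) ((s n @^-1` [set r]) `*` (f r @^-1` B)).
  apply/seteqP; split=> [[x t]/= Bf|[x t]/= [r _ [/= <-]]//].
  by exists (s n x) => //; exists x.
apply: fin_bigcup_measurable; first exact: fimfunP.
move=> r _; apply: measurableX; first exact: measurable_sfunP.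
by rewrite -[X in measurable X]setTI; exact: mf.
Qed.

Lemma lebesgue_measure_translate (t : R) (A : set R) : measurable A ->
  pushforward mu (fun x : R => x + t : measurableTypeR R) A = mu A.
Proof.
move=> mA; apply/esym/lebesgue_measure_unique => //=.
  exact: measurable_funD.
move=> ? _ [[a b]] _ <-.
rewrite /pushforward.
have -> : (fun x : R => x + t) @^-1` `]a, b]%classic = `]a - t, b - t]%classic.
  by apply/seteqP; split=> x /=; rewrite !in_itv/= ltrBlDr lerBrDr.
rewrite !lebesgue_measure_itv/= !lte_fin ltrD2r.
by case: ifP => // _; rewrite -!EFinD; congr EFin; ring.
Qed.

Lemma ge0_integral_translate (f : R -> \bar R) (t : R) :
  measurable_fun setT f -> (forall x, 0 <= f x)%E ->
  (\int[mu]_x f (x + t)%R = \int[mu]_x f x)%E.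
Proof.
move=> mf f0.
pose phi (x : measurableTypeR R) : measurableTypeR R := x + t.
have mt : measurable_fun setT phi by exact: measurable_funD.
transitivity (\int[pushforward mu phi]_x f x)%E.
  by rewrite ge0_integral_pushforward.
by apply: eq_measure_integral => A mA _; exact: lebesgue_measure_translate.
Qed.

(** On each horizontal line the shear is a translation, so Tonelli reduces the claim to one
    dimension. A constant [u] gives the translations of the plane used in [plane_int_affine]. *)
Lemma ge0_integral_shear1 (f : R * R -> \bar R) (u : R -> R) :
  measurable_fun setT f -> (forall p, 0 <= f p)%E -> measurable_fun setT u ->
  (\int[mu2]_p f (p.1 + u p.2, p.2)%R = \int[mu2]_p f p)%E.
Proof.
move=> mf f0 mu_.
have mh : measurable_fun setT (fun p : R * R => f (p.1 + u p.2, p.2)).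
  apply: (measurableT_comp mf); apply: measurable_fun_pair => //.
  by apply: measurable_funD => //; exact: measurableT_comp.
rewrite fubini_tonelli2; [|exact: mh|by move=> ?; exact: f0].
rewrite fubini_tonelli2; [|exact: mf|exact: f0].
apply: eq_integral => y _; rewrite /fubini_G /=.
apply: (@ge0_integral_translate (fun x => f (x, y))) => //.
exact: measurable_fun_pair1.
Qed.

Lemma ge0_integral_shear2 (f : R * R -> \bar R) (u : R -> R) :
  measurable_fun setT f -> (forall p, 0 <= f p)%E -> measurable_fun setT u ->
  (\int[mu2]_p f (p.1, p.2 + u p.1)%R = \int[mu2]_p f p)%E.
Proof.
move=> mf f0 mu_.
have mh : measurable_fun setT (fun p : R * R => f (p.1, p.2 + u p.1)).
  apply: (measurableT_comp mf); apply: measurable_fun_pair => //.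
  by apply: measurable_funD => //; exact: measurableT_comp.
rewrite fubini_tonelli1; [|exact: mh|by move=> ?; exact: f0].
rewrite fubini_tonelli1; [|exact: mf|exact: f0].
apply: eq_integral => x _; rewrite /fubini_F /=.
apply: (@ge0_integral_translate (fun y => f (x, y))) => //.
exact: measurable_fun_pair2.
Qed.

Lemma measurable_linear2 d (T : measurableType d) (g h : T -> R) (c d' : R) :
  measurable_fun setT g -> measurable_fun setT h ->
  measurable_fun setT (fun t => c * g t + d' * h t).
Proof. by move=> mg mh; apply: measurable_funD; exact: measurable_funM. Qed.

Definition rotate (c s : R) (p : R * R) : R * R :=
  (c * p.1 - s * p.2, s * p.1 + c * p.2).

Lemma measurable_rotate (c s : R) : measurable_fun setT (rotate c s).
Proof.
apply: measurable_fun_pair; last exact: measurable_linear2.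
by under eq_fun do rewrite -mulNr; exact: measurable_linear2.
Qed.

(* For s <> 0 a rotation is a product of three shears, the outer two with
   parameter (c - 1) / s and the middle one with parameter s. *)
Lemma ge0_integral_rotate (f : R * R -> \bar R) (c s : R) :
  measurable_fun setT f -> (forall p, 0 <= f p)%E -> c ^+ 2 + s ^+ 2 = 1 ->
  (\int[mu2]_p f (rotate c s p) = \int[mu2]_p f p)%E.
Proof.
move=> + + cs.
have rot c' s' : s' != 0 -> c' ^+ 2 + s' ^+ 2 = 1 -> forall g : R * R -> \bar R,
    measurable_fun setT g -> (forall p, 0 <= g p)%E ->
    (\int[mu2]_p g (rotate c' s' p) = \int[mu2]_p g p)%E.
  move=> s0 cs' g mg g0; pose t := (c' - 1) / s'.
  have mlin (k : R) : measurable_fun setT (fun x : R => k * x).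
    exact: measurable_funM.
  pose g1 (p : R * R) := g (p.1 + t * p.2, p.2).
  pose g2 (p : R * R) := g1 (p.1, p.2 + s' * p.1).
  have mg1 : measurable_fun setT g1.
    apply: measurableT_comp => //; apply: measurable_fun_pair => //.
    by apply: measurable_funD => //; exact: measurable_funM.
  have mg2 : measurable_fun setT g2.
    apply: measurableT_comp => //; apply: measurable_fun_pair => //.
    by apply: measurable_funD => //; exact: measurable_funM.
  rewrite -(ge0_integral_shear1 mg g0 (mlin t)).
  rewrite -(@ge0_integral_shear2 g1 _ mg1 (fun p => g0 _) (mlin s')).
  rewrite -(@ge0_integral_shear1 g2 _ mg2 (fun p => g0 _) (mlin t)).
  apply: eq_integral => -[x y] _; rewrite /g2 /g1 /rotate /=; congr (g (_, _)).
    have -> : c' * x - s' * y = c' * x - (1 - c' ^+ 2) / s' * y.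
      by rewrite (_ : 1 - c' ^+ 2 = s' * s') ?mulfK// -cs'; ring.
    by rewrite /t; field.
  by rewrite /t; field.
have [s0|s0] := eqVneq s 0; last by move=> mf f0; exact: rot.
move=> mf f0; have : c ^+ 2 == 1 by rewrite -cs s0 expr0n addr0.
rewrite sqrf_eq1 => /orP[] /eqP ->; rewrite s0.
  by apply: eq_integral => -[x y] _; rewrite /rotate !mul0r subr0 add0r !mul1r.
(* The half-turn, [c = -1], is a product of two quarter-turns, to which the case of nonzero sine
   applies. *)
have i1 : (0 : R) ^+ 2 + 1 ^+ 2 = 1 by rewrite expr0n expr1n add0r.
rewrite -[RHS](rot 0 1 (oner_neq0 _) i1)//.
rewrite -[RHS](rot 0 1 (oner_neq0 _) i1)//; last first.
  by apply: measurableT_comp => //; exact: measurable_rotate.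
by apply: eq_integral => -[x y] _; rewrite /rotate /=; congr (f (_, _)); ring.
Qed.

Definition of_pair (p : R * R) : R[i] := p.1 +i* p.2.

(* Functions on [R[i]] are measured through the coordinate map [of_pair]. *)
Definition cmeasurable d (T : measurableType d) (f : R[i] -> T) :=
  measurable_fun setT (f \o of_pair).

Definition plane_int (f : R[i] -> \bar R) : \bar R := (\int[mu2]_p f (of_pair p))%E.

Definition affine_pair (a b : R[i]) (p : R * R) : R * R :=
  let z := a * of_pair p + b in (Re z, Im z).

Lemma of_affine_pair a b p : of_pair (affine_pair a b p) = a * of_pair p + b.
Proof. by rewrite /affine_pair /of_pair; case: (_ + _). Qed.

Lemma affine_pairE a b p :
  affine_pair a b p = ((rotate (Re a) (Im a) p).1 + Re b, (rotate (Re a) (Im a) p).2 + Im b).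
Proof.
case: a b p => [c s] [b1 b2] [x y]; rewrite /affine_pair /rotate /=.
by rewrite [s * x + _]addrC.
Qed.

Lemma measurable_affine_pair a b : measurable_fun setT (affine_pair a b).
Proof.
rewrite (funext (affine_pairE a b)).
have [m1 m2] := (measurable_fun_pairP _).1 (measurable_rotate (Re a) (Im a)).
by apply: measurable_fun_pair; apply: measurable_funD.
Qed.

Lemma cmeasurable_affine d (T : measurableType d) (f : R[i] -> T) a b :
  cmeasurable f -> cmeasurable (fun z => f (a * z + b)).
Proof.
move=> mf; rewrite /cmeasurable.
have -> : (fun z => f (a * z + b)) \o of_pair = (f \o of_pair) \o affine_pair a b.
  by apply/funext => p /=; rewrite of_affine_pair.
by apply: measurableT_comp => //; exact: measurable_affine_pair.
Qed.

Lemma plane_int_affine (f : R[i] -> \bar R) a b : cmeasurable f ->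
  (forall z, 0 <= f z)%E -> cabs a = 1 ->
  plane_int (fun z => f (a * z + b)) = plane_int f.
Proof.
move=> mf f0 a1.
have cs : Re a ^+ 2 + Im a ^+ 2 = 1 by rewrite -cabs_sqr a1 expr1n.
rewrite /plane_int.
pose g1 (p : R * R) := f (of_pair (p.1, p.2 + Im b)).
pose g2 (p : R * R) := g1 (p.1 + Re b, p.2).
have mg1 : measurable_fun setT g1.
  apply: (measurableT_comp mf); apply: measurable_fun_pair => //.
  exact: measurable_funD.
have mg2 : measurable_fun setT g2.
  apply: (measurableT_comp mg1); apply: measurable_fun_pair => //.
  exact: measurable_funD.
have mc (k : R) : measurable_fun setT (fun _ : R => k) by exact: measurable_cst.
rewrite -(@ge0_integral_shear2 (f \o of_pair) _ mf (fun p => f0 _) (mc (Im b))).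
rewrite -(@ge0_integral_shear1 g1 _ mg1 (fun p => f0 _) (mc (Re b))).
rewrite -(@ge0_integral_rotate g2 _ _ mg2 (fun p => f0 _) cs).
by apply: eq_integral => p _; rewrite -of_affine_pair affine_pairE.
Qed.

Lemma cmeasurable_entire (f : R[i] -> R[i]) : entire f ->
  cmeasurable (fun z => cabs (f z)).
Proof.
move=> ef.
have mIm g : entire g -> cmeasurable (fun z => Im (g z)).
  move=> eg; apply: (@caratheodory_measurable _ _ (fun x y => Im (g (x +i* y)))).
    move=> y.
    have /closed_form_entire/closed_form_continuous[/(_ y) c _] := entireZ (c := - 'i) eg.
    have -> : (fun x => Im (g (x +i* y))) = (fun x => Re (- 'i * g (x +i* y))) => //.
    by apply/funext => x; case: (g _) => p q; simpc.
  move=> x; apply: continuous_measurable_fun; exact: continuous_Im_entire.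
have mRe : cmeasurable (fun z => Re (f z)).
  rewrite (_ : (fun z => Re (f z)) = (fun z => Im ('i * f z))).
    by apply: mIm; exact: entireZ.
  by apply/funext => x; case: (f _) => p q; simpc.
rewrite /cmeasurable.
have -> : (fun z => cabs (f z)) \o of_pair = (fun p =>
    ((Re (f (of_pair p))) ^+ 2 + (Im (f (of_pair p))) ^+ 2) `^ (2^-1)).
  apply/funext => p /=; rewrite powR12_sqrt ?addr_ge0 ?sqr_ge0//.
  by case: (f _).
apply: (measurableT_comp (measurable_powR _)).
apply: measurable_funD; apply: measurable_funX; first exact: mRe.
exact: mIm.
Qed.

End PlaneMeasure.

(** * Gaussian means of entire functions *)

(* [fubini_tonelli] does not apply directly: the library has no canonical
   sigma-finite structure on a product of sigma-finite measures. *)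
Lemma tonelli_product_swap d1 d2 d3 (T1 : measurableType d1) (T2 : measurableType d2)
    (T3 : measurableType d3) (R : realType) (m1 : {sigma_finite_measure set T1 -> \bar R})
    (m2 : {sigma_finite_measure set T2 -> \bar R})
    (m3 : {sigma_finite_measure set T3 -> \bar R})
    (H : (T1 * T2) * T3 -> \bar R) : measurable_fun setT H -> (forall q, 0 <= H q)%E ->
  (\int[m1 \x m2]_p \int[m3]_t H (p, t) = \int[m3]_t \int[m1 \x m2]_p H (p, t))%E.
Proof.
move=> mH H0.
have int0 d (T : measurableType d) (m : {measure set T -> \bar R}) (f : T -> \bar R) :
  (forall t, 0 <= f t)%E -> (0 <= \int[m]_t f t)%E by move=> f0; exact: integral_ge0.
(* The integral in [t] passes that in [y] and that in [x] separately, so each exchange concerns two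
   sigma-finite factors; [K] is the integrand between the two exchanges. *)
pose K (q : T1 * T3) : \bar R := (\int[m2]_y H ((q.1, y), q.2))%E.
have mK : measurable_fun setT K.
  pose H' (r : (T1 * T3) * T2) := H ((r.1.1, r.2), r.1.2).
  apply: (@measurable_fun_fubini_tonelli_F _ _ _ _ _ m2 H') => [|r]; last exact: H0.
  apply: (measurableT_comp mH); apply: measurable_fun_pair.
    apply: measurable_fun_pair => //.
    exact: (measurableT_comp measurable_fst measurable_fst).
  exact: (measurableT_comp measurable_snd measurable_fst).
have mHx x : measurable_fun setT (fun q : T2 * T3 => H ((x, q.1), q.2)).
  apply: (measurableT_comp mH); apply: measurable_fun_pair => //.
  exact: measurable_fun_pair.
rewrite fubini_tonelli1; last first.
- by move=> p; exact: int0.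
- exact: measurable_fun_fubini_tonelli_F.
transitivity (\int[m1]_x \int[m3]_t K (x, t))%E.
  apply: eq_integral => x _.
  exact: (@fubini_tonelli _ _ _ _ _ m2 m3 (fun q => H ((x, q.1), q.2))).
rewrite fubini_tonelli//; last by move=> q; exact: int0.
apply: eq_integral => t _; rewrite fubini_tonelli1//.
exact: measurable_fun_pair1.
Qed.

Section FockSpace.
Context {R : realType}.
Notation mu := (@lebesgue_measure R).
Notation mu2 := (mu \x mu)%E.
Implicit Types (z a b : R[i]) (nu : R).

Lemma plane_int_ge0 (f : R[i] -> \bar R) : (forall z, 0 <= f z)%E ->
  (0 <= plane_int f)%E.
Proof. by move=> f0; apply: integral_ge0 => p _; exact: f0. Qed.

Lemma le_plane_int (f g : R[i] -> \bar R) : cmeasurable f -> cmeasurable g ->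
  (forall z, 0 <= f z)%E -> (forall z, f z <= g z)%E ->
  (plane_int f <= plane_int g)%E.
Proof.
by move=> mf mg f0 fg; exact: ge0_le_integral.
Qed.

Lemma eq_plane_int (f g : R[i] -> \bar R) : (forall z, f z = g z) ->
  plane_int f = plane_int g.
Proof. by move=> fg; congr plane_int; apply/funext. Qed.

Lemma plane_intZ (k : R) (f : R[i] -> \bar R) : 0 <= k -> cmeasurable f ->
  (forall z, 0 <= f z)%E ->
  plane_int (fun z => k%:E * f z)%E = (k%:E * plane_int f)%E.
Proof. by move=> k0 mf f0; rewrite /plane_int ge0_integralZl_EFin. Qed.

Lemma plane_intD (f g : R[i] -> R) : cmeasurable f -> cmeasurable g ->
  (forall z, 0 <= f z) -> (forall z, 0 <= g z) ->
  (plane_int (fun z => (f z + g z)%:E) =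
   plane_int (fun z => (f z)%:E) + plane_int (fun z => (g z)%:E))%E.
Proof.
move=> mf mg f0 g0; rewrite /plane_int.
under eq_integral do rewrite EFinD.
rewrite ge0_integralD//.
- by move=> p _; rewrite lee_fin.
- exact/measurable_EFinP.
- by move=> p _; rewrite lee_fin.
- exact/measurable_EFinP.
Qed.

Definition gauss nu z : R := expR (- nu * (Re z ^+ 2 + Im z ^+ 2) / 2).

Lemma gauss_gt0 nu z : 0 < gauss nu z.
Proof. exact: expR_gt0. Qed.

Lemma gauss_cabs nu z : gauss nu z = expR (- nu * cabs z ^+ 2 / 2).
Proof. by rewrite /gauss cabs_sqr. Qed.

Lemma cmeasurable_gauss nu : cmeasurable (gauss nu).
Proof.
apply: (measurableT_comp (@measurable_expR R)).
apply: measurable_funM => //; apply: measurable_funM => //.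
apply: measurable_funD; apply: measurable_funX; first exact: measurable_fst.
exact: measurable_snd.
Qed.

Lemma fock_integralE nu (f : R[i] -> R[i]) :
  fock_integral nu f = plane_int (fun z => (cabs (f z) `^ nu * gauss nu z)%:E).
Proof. by []. Qed.

Lemma cmeasurable_fock nu (f : R[i] -> R[i]) : entire f ->
  cmeasurable (fun z => cabs (f z) `^ nu * gauss nu z).
Proof.
move=> ef; apply: measurable_funM; last exact: cmeasurable_gauss.
apply: (measurableT_comp (measurable_powR _)); exact: cmeasurable_entire.
Qed.

(** Finite because [1 <= nu] puts the integrand below a multiple of the standard normal density;
    positive because it is at least [expR (- nu / 2)] on the unit interval. *)
Lemma gauss1_integral nu : 1 <= nu -> exists2 I : R, 0 < I &
  (\int[mu]_x (expR (- nu * x ^+ 2 / 2))%:E = I%:E)%E.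
Proof.
move=> nu1; set phi := fun x : R => expR (- nu * x ^+ 2 / 2).
have mphi : measurable_fun setT phi.
  apply: (measurableT_comp (@measurable_expR R)).
  by apply: measurable_funM => //; apply: measurable_funM => //; exact: measurable_funX.
have mphiE : measurable_fun setT (EFin \o phi) by exact/measurable_EFinP.
have fin : (\int[mu]_x (phi x)%:E < +oo)%E.
  pose k : R := Num.sqrt (1 ^+ 2 * pi *+ 2).
  have pk0 : 0 < 1 ^+ 2 * pi *+ 2 :> R by rewrite expr1n mul1r mulrn_wgt0// pi_gt0.
  have k0 : 0 < k by rewrite sqrtr_gt0.
  have n0 x : 0 <= normal_pdf 0 1 x :> R by exact: normal_pdf_ge0.
  apply: (@le_lt_trans _ _ (\int[mu]_x (k%:E * (normal_pdf 0 1 x)%:E))%E).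
    apply: ge0_le_integral => //.
    - by move=> x _; rewrite lee_fin expR_ge0.
    - apply: measurable_funeM; apply/measurable_EFinP; exact: measurable_normal_pdf.
    move=> x _; rewrite -EFinM lee_fin normal_pdfE ?oner_neq0//.
    rewrite /normal_peak mulrA mulfV ?gt_eqF// mul1r /normal_fun ler_expR.
    rewrite subr0 expr1n !mulNr lerN2 ler_pM2r ?invr_gt0//.
    by rewrite ler_peMl// sqr_ge0.
  rewrite ge0_integralZl_EFin//; last 3 first.
  - by move=> x _; rewrite lee_fin.
  - apply/measurable_EFinP; exact: measurable_normal_pdf.
  - exact: ltW.
  by rewrite integral_normal_pdf mule1 ltry.
have ge0 : (0 <= \int[mu]_x (phi x)%:E)%E.
  by apply: integral_ge0 => x _; rewrite lee_fin expR_ge0.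
exists (fine (\int[mu]_x (phi x)%:E)%E); last by rewrite fineK// ge0_fin_numE.
apply: (@lt_le_trans _ _ (expR (- nu / 2))); first exact: expR_gt0.
rewrite -lee_fin fineK; last by rewrite ge0_fin_numE.
apply: (@le_trans _ _ (\int[mu]_(x in `[0%R, 1%R]) (expR (- nu / 2))%:E)%E).
  rewrite integral_cst//.
  have /= -> := lebesgue_measure_itv `[0 : R, 1].
  by rewrite lte_fin ltr01 -EFinD subr0 mule1.
apply: (@le_trans _ _ (\int[mu]_(x in `[0%R, 1%R]) (phi x)%:E)%E).
  apply: ge0_le_integral => //.
    exact: measurable_funTS.
  move=> x /=; rewrite in_itv/= => /andP[x0 x1]; rewrite lee_fin /phi ler_expR.
  rewrite ler_pM2r ?invr_gt0// !mulNr lerN2 ler_piMr ?expr_le1//.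
  by apply: le_trans nu1.
apply: ge0_subset_integral => //.
by move=> x _; rewrite lee_fin expR_ge0.
Qed.

Lemma gauss_integral nu : 1 <= nu -> exists2 G : R, 0 < G &
  plane_int (fun z => (gauss nu z)%:E) = G%:E.
Proof.
move=> /gauss1_integral[I I0 HI]; exists (I * I); first exact: mulr_gt0.
rewrite /plane_int fubini_tonelli1; first last.
- by move=> p; rewrite lee_fin expR_ge0.
- by apply/measurable_EFinP; exact: cmeasurable_gauss.
have mphi : measurable_fun setT (fun x : R => (expR (- nu * x ^+ 2 / 2))%:E).
  apply/measurable_EFinP; apply: (measurableT_comp (@measurable_expR R)).
  by apply: measurable_funM => //; apply: measurable_funM => //; exact: measurable_funX.
transitivity (\int[mu]_x (I%:E * (expR (- nu * x ^+ 2 / 2))%:E))%E.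
  apply: eq_integral => x _; rewrite /fubini_F /= /gauss/=.
  under eq_integral do rewrite mulrDr mulrDl expRD EFinM.
  by rewrite ge0_integralZl_EFin ?expR_ge0// HI muleC.
by rewrite ge0_integralZl_EFin ?HI// ltW.
Qed.

Definition circle_int (h : R[i] -> R) z : \bar R :=
  (\int[mu]_(t in `[0%R, (2 * pi)%R]) (h (z * cexp (0 +i* t)))%:E)%E.

(** A substitute for polar coordinates: Tonelli exchanges the angle with the point of the plane, and
    for a fixed angle the rotation preserves the plane integral. *)
Lemma rotation_average (h : R[i] -> R) : cmeasurable h -> (forall z, 0 <= h z) ->
  cmeasurable (circle_int h) /\
  plane_int (circle_int h) = ((2 * pi)%:E * plane_int (fun z => (h z)%:E))%E.
Proof.
move=> mh h0.
have p0 : 0 <= 2 * pi :> R by exact: pi2_ge0.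
pose H (q : (R * R) * R) : \bar R :=
  (h (of_pair (rotate (cos q.2) (sin q.2) q.1)) * \1_`[0, 2 * pi] q.2)%:E.
have rotE p t : of_pair p * cexp (0 +i* t) = of_pair (rotate (cos t) (sin t) p).
  case: p => x y; rewrite /cexp /of_pair /rotate /= expR0 !mul1r; simpc.
  by congr Complex; ring.
have H0 q : (0 <= H q)%E by rewrite lee_fin mulr_ge0.
have mH : measurable_fun setT H.
  apply/measurable_EFinP; apply: measurable_funM; last first.
    by apply: measurableT_comp => //; exact: measurable_indic.
  apply: (measurableT_comp mh).
  have mcos : measurable_fun setT (fun q : (R * R) * R => cos q.2).
    apply: (measurableT_comp _ measurable_snd).
    by apply: continuous_measurable_fun; exact: continuous_cos.
  have msin : measurable_fun setT (fun q : (R * R) * R => sin q.2).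
    apply: (measurableT_comp _ measurable_snd).
    by apply: continuous_measurable_fun; exact: continuous_sin.
  have m11 : measurable_fun setT (fun q : (R * R) * R => q.1.1).
    exact: (measurableT_comp measurable_fst measurable_fst).
  have m12 : measurable_fun setT (fun q : (R * R) * R => q.1.2).
    exact: (measurableT_comp measurable_snd measurable_fst).
  apply: measurable_fun_pair.
    by apply: measurable_funB; apply: measurable_funM.
  by apply: measurable_funD; apply: measurable_funM.
have HE : circle_int h \o of_pair = fubini_F mu H.
  apply/funext => p; rewrite /circle_int /fubini_F /= integral_mkcond.
  apply: eq_integral => t _; rewrite /H /= patchE rotE indicE.
  by case: ifP => _; rewrite ?mulr1 ?mulr0.
split; first by rewrite /cmeasurable HE; exact: measurable_fun_fubini_tonelli_F.
transitivity (\int[mu2]_p \int[mu]_t H (p, t))%E.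
  by rewrite /plane_int -[RHS]/(\int[mu2]_p fubini_F mu H p)%E -HE.
rewrite tonelli_product_swap//.
transitivity (\int[mu]_(t in `[0%R, (2 * pi)%R]) plane_int (fun z => (h z)%:E))%E.
  rewrite [RHS]integral_mkcond; apply: eq_integral => t _; rewrite patchE /H /= indicE.
  case: ifP => _ /=; last by under eq_integral do rewrite mulr0; rewrite integral0.
  have c1 : cabs (cexp (0 +i* t)) = 1 :> R by rewrite cabs_cexp /= expR0.
  rewrite -[RHS](@plane_int_affine _ _ (cexp (0 +i* t)) 0 _ _ c1); first last.
  - by move=> z; rewrite lee_fin.
  - exact/measurable_EFinP.
  by apply: eq_integral => p _; rewrite mulr1 addr0 mulrC rotE.
rewrite integral_cst// muleC; congr (_ * _)%E.
have /= -> := lebesgue_measure_itv `[0 : R, 2 * pi].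
rewrite lte_fin mulr_gt0 ?pi_gt0//.
by rewrite -EFinD subr0.
Qed.

Lemma continuous_cabs_entire (F : R[i] -> R[i]) (s : R) : entire F ->
  continuous (fun t => cabs (F (s +i* t))).
Proof.
move=> eF t.
have -> : (fun t => cabs (F (s +i* t))) =
    (fun t => Num.sqrt (Re (F (s +i* t)) ^+ 2 + Im (F (s +i* t)) ^+ 2)).
  by apply/funext => u; case: (F _).
apply: (cvg_comp _ Num.sqrt); last exact: sqrt_continuous.
apply: cvgD; apply: (cvg_comp _ (fun x => x ^+ 2)).
- exact: continuous_Re_entire.
- exact: exprn_continuous.
- exact: continuous_Im_entire.
- exact: exprn_continuous.
Qed.

(** The real and imaginary parts of [g z0] are each bounded by the mean of the modulus, whence the
    factor 2. *)
Lemma mean_value_cabs (g : R[i] -> R[i]) z0 z : entire g ->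
  ((cabs (g z0) * (2 * pi))%:E <=
   2%:E * \int[mu]_(t in `[0%R, (2 * pi)%R]) (cabs (g (z0 + z * cexp (0 +i* t))))%:E)%E.
Proof.
move=> eg; have p0 : 0 <= 2 * pi :> R by exact: pi2_ge0.
pose F w := g (z0 + z * cexp w).
have eF : entire F.
  apply: (entire_comp eg); apply: entireD; first exact: entire_cst.
  exact/entireZ/entire_cexp.
have cF := continuous_cabs_entire (s := 0) eF.
have intF := continuous_seg_integrable 0 (2 * pi) cF.
rewrite -[X in (_ * X)%E]fineK; last exact: integrable_fin_num.
rewrite -EFinM lee_fin -/(Rintegral _ _ _) -/(seg_int _ 0 (2 * pi)).
have le_seg (u : R -> R) : continuous u -> (forall t, `|u t| <= cabs (F (0 +i* t))) ->
    `|seg_int u 0 (2 * pi)| <= seg_int (fun t => cabs (F (0 +i* t))) 0 (2 * pi).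
  move=> cu uF; have iu := continuous_seg_integrable 0 (2 * pi) cu.
  apply: le_trans (le_normr_Rintegral _ iu) _ => //.
  apply: le_Rintegral => //.
    apply: (@continuous_seg_integrable _ (fun x => `|u x|)).
    by move=> x; apply: cvg_norm; exact: cu.
have HRe := le_seg _ (continuous_Re_entire (s := 0) eF) (fun t => Re_le_cabs _).
have HIm := le_seg _ (continuous_Im_entire (s := 0) eF) (fun t => Im_le_cabs _).
rewrite (mean_value_Re _ _ eg) normrM (ger0_norm p0) in HRe.
rewrite (mean_value_Im _ _ eg) normrM (ger0_norm p0) in HIm.
have dbl (x : R) : 2 * x = x + x by rewrite mulr_natl mulr2n.
rewrite [leRHS]dbl; apply: le_trans (lerD HRe HIm); rewrite -mulrDl.
exact: (ler_wpM2r p0 (cabs_le_ReIm _)).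
Qed.

(** The Gaussian is constant on circles about 0, so it multiplies the inequality of
    [mean_value_cabs] at [z0] inside the circle integral. Integrating over the plane bounds
    [G * cabs (g z0)] by twice the Gaussian mean of [cabs (g (z + z0))], which is at most
    [G + K]. *)
Lemma entire_bounded_of_fock_means nu K (g : R[i] -> R[i]) : 1 <= nu -> entire g ->
  (forall z0, plane_int (fun z => (cabs (g (z + z0)) `^ nu * gauss nu z)%:E) <= K%:E)%E ->
  exists C, forall z, cabs (g z) <= C.
Proof.
move=> nu1 eg gK; have [G G0 HG] := gauss_integral nu1.
exists (2 * (G + K) / G) => z0.
have eg0 : entire (fun z => g (z + z0)).
  by apply: (entire_comp eg); apply: entireD; [exact: entire_id|exact: entire_cst].
pose h z := cabs (g (z + z0)) * gauss nu z.
have mh : cmeasurable h.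
  by apply: measurable_funM; [exact: (cmeasurable_entire eg0)|exact: cmeasurable_gauss].
have h0 z : 0 <= h z by rewrite mulr_ge0 ?cabs_ge0// expR_ge0.
have p0 : 0 < 2 * pi :> R by rewrite mulr_gt0// pi_gt0.
have hGK : (plane_int (fun z => (h z)%:E) <= (G + K)%:E)%E.
  rewrite EFinD -HG; apply: le_trans (leeD2l _ (gK z0)).
  have f0 z : 0 <= cabs (g (z + z0)) `^ nu * gauss nu z.
    by rewrite mulr_ge0 ?powR_ge0// expR_ge0.
  rewrite -(plane_intD (cmeasurable_gauss nu) (cmeasurable_fock nu eg0)
    (fun z => ltW (gauss_gt0 _ _)) f0).
  apply: le_plane_int.
  - exact/measurable_EFinP.
  - apply/measurable_EFinP; apply: measurable_funD; first exact: cmeasurable_gauss.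
    exact: (cmeasurable_fock nu eg0).
  - by move=> z; rewrite lee_fin.
  (* What remains is [t <= 1 + t ^ nu], true for [t <= 1] and, since [1 <= nu], for larger [t]. *)
  move=> z; rewrite lee_fin /h -[X in _ <= X + _]mul1r -mulrDl ler_pM2r ?gauss_gt0//.
  set t := cabs _; have [t1|t1] := leP t 1.
    by apply: le_trans t1 _; rewrite lerDl powR_ge0.
  by apply: le_trans (le1r_powR (ltW t1) nu1) _; rewrite lerDr.
have [mci cih] := rotation_average mh h0.
have le1 : ((cabs (g z0) * (2 * pi))%:E * G%:E <=
    2%:E * ((2 * pi)%:E * plane_int (fun z => (h z)%:E)))%E.
  have k0 : 0 <= cabs (g z0) * (2 * pi) by rewrite mulr_ge0 ?cabs_ge0// ltW.
  have mgauss : cmeasurable (fun z => (gauss nu z)%:E).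
    by apply/measurable_EFinP; exact: cmeasurable_gauss.
  have gauss0 z : (0 <= (gauss nu z)%:E)%E by rewrite lee_fin ltW// gauss_gt0.
  have ci0 z : (0 <= circle_int h z)%E by apply: integral_ge0 => t _; rewrite lee_fin.
  rewrite -HG -cih -(plane_intZ k0 mgauss gauss0) -(plane_intZ (ler0n _ 2) mci ci0).
  apply: le_plane_int.
  - exact: measurable_funeM.
  - exact: measurable_funeM.
  - by move=> z; rewrite mule_ge0// lee_fin.
  move=> z.
  have eF : entire (fun w => g (z0 + z * cexp w)).
    apply: (entire_comp eg); apply: entireD; first exact: entire_cst.
    exact/entireZ/entire_cexp.
  have -> : circle_int h z = ((gauss nu z)%:E *
      \int[mu]_(t in `[0%R, (2 * pi)%R]) (cabs (g (z0 + z * cexp (0 +i* t))))%:E)%E.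
    rewrite -ge0_integralZl_EFin; first last.
    - exact/ltW/gauss_gt0.
    - apply/measurable_EFinP; apply: measurable_funTS.
      apply: continuous_measurable_fun.
      exact: (continuous_cabs_entire (s := 0) eF).
    - by move=> t _; rewrite lee_fin cabs_ge0.
    - exact: measurable_itv.
    apply: eq_integral => t _; rewrite /h mulrC EFinM [_ + z0]addrC.
    congr (_%:E * _)%E.
    by rewrite !gauss_cabs cabsM cabs_cexp /= expR0 mulr1.
  rewrite muleCA muleC; apply: lee_wpmul2l => //.
  exact: mean_value_cabs.
have := le_trans le1 (lee_wpmul2l _ (lee_wpmul2l _ hGK)).
rewrite -!EFinM !lee_fin ler0n (ltW p0) => /(_ isT isT) H.
rewrite ler_pdivlMr// -(ler_pM2r p0).
by move: H; rewrite mulrAC [2 * (2 * pi * _)]mulrCA mulrC [_ * (2 * (G + K))]mulrC.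
Qed.
End FockSpace.

(** * Weighted composition operators on Fock spaces *)

Section WeightedComposition.
Context {R : realType}.
Implicit Types (z a b : R[i]) (nu : R).

Lemma powR_expR (x r : R) : expR x `^ r = expR (r * x).
Proof. by rewrite /powR gt_eqF ?expR_gt0// expRK. Qed.

Lemma cabsD_sqr (u v : R[i]) :
  cabs (u + v) ^+ 2 = cabs u ^+ 2 + cabs v ^+ 2 + 2 * Re (conjc v * u).
Proof. by rewrite !cabs_sqr; case: u v => [p q] [r s] /=; ring. Qed.

(* Since |a| = 1, |az + b|^2 = |z|^2 + |b|^2 + 2 Re (conj b * a * z): moving the
   Gaussian weight from z to az + b costs exactly the modulus of the
   exponential factor and a constant. *)
Lemma weighted_fock_density nu a b (w : R[i] -> R[i]) (t : R) z :
  cabs a = 1 -> 0 <= t ->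
  (cabs (w z) * t) `^ nu * gauss nu z =
  (expR (cabs b ^+ 2 / 2) * cabs (w z * cexp (conjc b * a * z))) `^ nu *
    (t `^ nu * gauss nu (a * z + b)).
Proof.
move=> a1 t0; rewrite cabsM cabs_cexp !gauss_cabs cabsD_sqr cabsM a1 mul1r.
rewrite -(mulrA (conjc b) a z).
set e := Re _; set x := cabs z; set y := cabs b.
rewrite !powRM ?mulr_ge0 ?cabs_ge0 ?expR_ge0// !powR_expR.
rewrite [RHS](_ : _ = cabs (w z) `^ nu * t `^ nu *
  (expR (nu * (y ^+ 2 / 2)) * expR (nu * e) *
   expR (- nu * (x ^+ 2 + y ^+ 2 + 2 * e) / 2))); last by ring.
rewrite -!expRD; congr (_ * _); congr expR.
by field.
Qed.

(* The modulus of [fock_kernel zeta z] is exp (|z|^2/2 - |z - zeta|^2/2): these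
   are the normalized reproducing kernels of the Fock space. *)
Definition fock_kernel (zeta z : R[i]) : R[i] :=
  cexp (conjc zeta * z - (cabs zeta ^+ 2 / 2)%:C).

Lemma entire_fock_kernel (zeta : R[i]) : entire (fock_kernel zeta).
Proof.
apply: (entire_comp entire_cexp); apply: entireD; last exact: entire_cst.
exact/entireZ/entire_id.
Qed.

Lemma fock_kernel_density nu (zeta u : R[i]) :
  cabs (fock_kernel zeta u) `^ nu * gauss nu u = gauss nu (u - zeta).
Proof.
rewrite cabs_cexp powR_expR !gauss_cabs cabsD_sqr cabsN -expRD; congr expR.
have -> : Re (conjc (- zeta) * u) = - Re (conjc zeta * u).
  by case: zeta u => [p q] [r s] /=; ring.
have -> : Re (conjc zeta * u - (cabs zeta ^+ 2 / 2)%:C) =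
    Re (conjc zeta * u) - cabs zeta ^+ 2 / 2 by case: (_ * u).
by field.
Qed.

Lemma cmeasurable_EFin (f : R[i] -> R) : cmeasurable f ->
  cmeasurable (fun z => (f z)%:E).
Proof. by move=> mf; apply/measurable_EFinP. Qed.

Lemma fock_integral_kernel nu (zeta : R[i]) :
  fock_integral nu (fock_kernel zeta) = plane_int (fun z => (gauss nu z)%:E).
Proof.
have gauss0 z : (0 <= (gauss nu z)%:E)%E by rewrite lee_fin ltW// gauss_gt0.
have c1 : cabs (1 : R[i]) = 1 by exact: Normc.normc1.
have mgauss := cmeasurable_EFin (cmeasurable_gauss nu).
rewrite fock_integralE -(plane_int_affine (- zeta) mgauss gauss0 c1).
by apply: eq_plane_int => z; rewrite fock_kernel_density mul1r.
Qed.

Lemma fock_integral_ge0 nu (f : R[i] -> R[i]) : (0 <= fock_integral nu f)%E.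
Proof.
rewrite fock_integralE; apply: plane_int_ge0 => z.
by rewrite lee_fin mulr_ge0 ?powR_ge0// expR_ge0.
Qed.

Lemma fock_integral_fineK nu (f : R[i] -> R[i]) : in_fock nu f ->
  (fine (fock_integral nu f))%:E = fock_integral nu f.
Proof. by move=> [_ f_fin]; rewrite fineK// ge0_fin_numE// fock_integral_ge0. Qed.

Lemma in_fock_kernel nu (zeta : R[i]) : 1 <= nu -> in_fock nu (fock_kernel zeta).
Proof.
move=> /gauss_integral[G _ HG]; split; first exact: entire_fock_kernel.
by rewrite fock_integral_kernel HG ltry.
Qed.

(** Boundedness alone forces the weight [w 0 * cexp (- (conjc b * a * z))]. *)
Lemma normalized_weight_const nu a b (w : R[i] -> R[i]) :
  1 <= nu -> cabs a = 1 -> entire w -> bounded_on nu (Wop w a b) ->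
  forall z, w z * cexp (conjc b * a * z) = w 0.
Proof.
move=> nu1 a1 ew [M bM].
have nu0 : 0 < nu by exact: lt_le_trans nu1.
have p0 : 0 < nu / (2 * pi) :> R by rewrite divr_gt0// mulr_gt0// pi_gt0.
pose g z := w z * cexp (conjc b * a * z).
have eg : entire g.
  apply: (entireM ew); apply: (entire_comp entire_cexp); exact/entireZ/entire_id.
have [G G0 HG] := gauss_integral nu1.
pose N := (nu / (2 * pi) * G) `^ (1 / nu).
(* [N] is the common norm of all kernels; [K] is the bound [M * N] on the norms of their images,
   rewritten as a bound on the integral inside [fock_norm]. *)
pose K := (M * N) `^ nu / (nu / (2 * pi)).
have WK zeta : (fock_integral nu (Wop w a b (fock_kernel zeta)) <= K%:E)%E.
  have [inW] := bM _ (in_fock_kernel zeta nu1).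
  rewrite -(fock_integral_fineK inW) lee_fin /fock_norm fock_integral_kernel HG /=.
  rewrite -/N; set I := fine _ => le.
  have I0 : 0 <= I by apply: fine_ge0; exact: fock_integral_ge0.
  rewrite ler_pdivlMr// mulrC.
  have pI0 : 0 <= nu / (2 * pi) * I by rewrite mulr_ge0// ltW.
  have := @ge0_ler_powR R nu (ltW nu0) _ _ _ _ le.
  rewrite -powRrM div1r mulVf ?gt_eqF// powRr1//; apply.
    by rewrite nnegrE powR_ge0.
  by rewrite nnegrE; apply: le_trans le; exact: powR_ge0.
have c0 : 0 < expR (cabs b ^+ 2 / 2) by exact: expR_gt0.
have gK z0 : (plane_int (fun z => (cabs (g (z + z0)) `^ nu * gauss nu z)%:E) <=
    (K / expR (cabs b ^+ 2 / 2) `^ nu)%:E)%E.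
  have mg : cmeasurable (fun z => cabs (g z) `^ nu * gauss nu (1 * z + - z0)).
    apply: measurable_funM.
      apply: (measurableT_comp (measurable_powR _)); exact: cmeasurable_entire.
    exact: (cmeasurable_affine 1 (- z0) (cmeasurable_gauss nu)).
  have mg0 z : (0 <= (cabs (g z) `^ nu * gauss nu (1 * z + - z0))%:E)%E.
    by rewrite lee_fin mulr_ge0 ?powR_ge0// expR_ge0.
  have c1 : cabs (1 : R[i]) = 1 by exact: Normc.normc1.
  rewrite (eq_plane_int (g := fun z =>
      (cabs (g (1 * z + z0)) `^ nu * gauss nu (1 * (1 * z + z0) + - z0))%:E)); last first.
    by move=> z; rewrite !mul1r addrK.
  rewrite (plane_int_affine z0 (cmeasurable_EFin mg) mg0 c1).
  rewrite EFinM lee_pdivlMr ?powR_gt0// muleC.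
  rewrite -(plane_intZ (powR_ge0 _ _) (cmeasurable_EFin mg) mg0).
  (* With the kernel centred at the image of [z0], the Gaussian is evaluated at [a * (z - z0)]; as
     [a] has modulus 1, it is the Gaussian centred at [z0]. *)
  apply: le_trans (WK (a * z0 + b)); rewrite fock_integralE le_eqVlt; apply/orP; left.
  apply/eqP; apply: eq_plane_int => z; rewrite -EFinM; congr EFin.
  rewrite /Wop cabsM (weighted_fock_density nu b w z a1) ?cabs_ge0//.
  rewrite fock_kernel_density powRM ?cabs_ge0 ?expR_ge0// -/(g z) !mulrA; congr (_ * _).
  have -> : a * z + b - (a * z0 + b) = a * (1 * z + - z0) by ring.
  by rewrite !gauss_cabs cabsM a1 !mul1r.
have [C gC] := entire_bounded_of_fock_means nu1 eg gK.
move=> z; rewrite -/(g z) (Liouville eg gC z) /g mulr0.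
by rewrite cexp0 mulr1.
Qed.

Lemma fock_norm_Wop nu a b (w f : R[i] -> R[i]) :
  1 <= nu -> cabs a = 1 -> entire w -> bounded_on nu (Wop w a b) -> in_fock nu f ->
  fock_norm nu (Wop w a b f) = expR (cabs b ^+ 2 / 2) * cabs (w 0) * fock_norm nu f.
Proof.
move=> nu1 a1 ew bW inf.
have nu0 : nu != 0 by rewrite gt_eqF//; exact: lt_le_trans nu1.
have wE := normalized_weight_const nu1 a1 ew bW.
set c := expR _ * _; have c0 : 0 <= c by rewrite mulr_ge0 ?expR_ge0// cabs_ge0.
have fE : fock_integral nu (Wop w a b f) = ((c `^ nu)%:E * fock_integral nu f)%E.
  have mf := cmeasurable_EFin (cmeasurable_fock nu inf.1).
  have f0 z : (0 <= (cabs (f z) `^ nu * gauss nu z)%:E)%E.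
    by rewrite lee_fin mulr_ge0 ?powR_ge0// expR_ge0.
  rewrite !fock_integralE -(plane_int_affine b mf f0 a1).
  rewrite -plane_intZ ?powR_ge0//; last exact: (cmeasurable_affine a b mf).
  apply: eq_plane_int => z; rewrite -EFinM; congr EFin.
  by rewrite /Wop cabsM (weighted_fock_density nu b w z a1) ?cabs_ge0// wE.
have I0 : 0 <= fine (fock_integral nu f) by apply: fine_ge0; exact: fock_integral_ge0.
have p0 : 0 <= nu / (2 * pi) :> R.
  by rewrite divr_ge0 ?mulr_ge0 ?pi_ge0//; exact: le_trans nu1.
rewrite /fock_norm fE -(fock_integral_fineK inf) -EFinM /= mulrCA.
rewrite (powRM _ (powR_ge0 c nu) (mulr_ge0 p0 I0)) -powRrM.
by rewrite div1r mulfV// powRr1.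
Qed.

Lemma fock_norm_iter_Wop nu a b (w f : R[i] -> R[i]) (n : nat) :
  1 <= nu -> cabs a = 1 -> entire w -> bounded_on nu (Wop w a b) -> in_fock nu f ->
  fock_norm nu (iter n (Wop w a b) f) =
  (expR (cabs b ^+ 2 / 2) * cabs (w 0)) ^+ n * fock_norm nu f.
Proof.
move=> nu1 a1 ew bW inf.
have initer k : in_fock nu (iter k (Wop w a b) f).
  by elim: k => [//|k IH]; have [M bM] := bW; have [] := bM _ IH.
set c := _ * cabs (w 0).
elim: n => [|n IH]; first by rewrite expr0 mul1r.
by rewrite /= (fock_norm_Wop nu1 a1 ew bW (initer n)) IH -/c (exprS c) mulrA.
Qed.

Lemma bounded_powers_le1 (c M : R) : (forall n, (1 <= n)%N -> c ^+ n <= M) -> c <= 1.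
Proof.
move=> cM; rewrite leNgt; apply/negP => c1.
have bernoulli n : 1 + n%:R * (c - 1) <= c ^+ n.
  elim: n => [|n IH]; first by rewrite mul0r addr0 expr0.
  have n0 : 0 <= n%:R :> R by rewrite ler0n.
  have : c * (1 + n%:R * (c - 1)) <= c * c ^+ n by rewrite ler_pM2l//; lra.
  rewrite -exprS -natr1; apply: le_trans.
  have : 0 <= n%:R * ((c - 1) * (c - 1)) by rewrite mulr_ge0// -expr2 sqr_ge0.
  by lra.
have [n nM] : exists n, M < n%:R * (c - 1).
  exists (Num.truncn (M / (c - 1))).+1; rewrite -ltr_pdivrMr ?subr_gt0//.
  exact: truncnS_gt.
have n1 : (1 <= n.+1)%N by [].
have := le_trans (bernoulli n.+1) (cM _ n1); rewrite -natr1.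
by lra.
Qed.

End WeightedComposition.

Unset Implicit Arguments.

Theorem theorem3p1 (R : realType) (nu : R) (a b : R[i]) (w : R[i] -> R[i]) :
  1 <= nu -> cabs a = 1 -> entire w -> bounded_on nu (Wop w a b) ->
  (power_bounded nu (Wop w a b) <-> cabs (w 0) <= expR (- (cabs b) ^+ 2 / 2)).
Proof.
move=> nu1 a1 ew bW; set c := expR (cabs b ^+ 2 / 2) * cabs (w 0).
have -> : (cabs (w 0) <= expR (- cabs b ^+ 2 / 2)) = (c <= 1).
  by rewrite mulNr expRN -[leRHS]mul1r ler_pdivlMr ?expR_gt0// mulrC.
have c0 : 0 <= c by rewrite mulr_ge0 ?expR_ge0// cabs_ge0.
split=> [[M HM]|c1].
  (* [fock_kernel 0] is the constant function 1; its nonzero norm cancels, leaving [c ^+ n <= M] for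
     all positive [n]. *)
  have in1 := in_fock_kernel 0 nu1.
  have N0 : 0 < fock_norm nu (fock_kernel 0).
    have [G G0 HG] := gauss_integral nu1.
    rewrite /fock_norm fock_integral_kernel HG powR_gt0// mulr_gt0//.
    by rewrite divr_gt0 ?mulr_gt0 ?pi_gt0//; exact: lt_le_trans nu1.
  apply: (@bounded_powers_le1 _ c M) => n n1.
  by have := HM n n1 _ in1; rewrite fock_norm_iter_Wop// ler_pM2r.
exists 1 => n _ f inf; rewrite fock_norm_iter_Wop//.
by rewrite ler_wpM2r ?powR_ge0// exprn_ile1.
Qed.
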